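(* For all sufficiently large $\alpha>0$, there exists a non-zero, mean-free field $B_0\in L^\infty(\mathbb T^3;\mathbb R^3)$ such that $\operatorname{div}B_0=0$ in the sense of distributions and $B_0(\boldsymbol x)\in E^u(\boldsymbol x)$ for almost every $\boldsymbol x\in\mathbb T^3$.
   Context: $\mathbb T=\mathbb R/2\pi\mathbb Z$, $\mathbb T^3=\mathbb R^3/(2\pi\mathbb Z)^3$; $h:\mathbb T\to[0,\pi]$ is the $2\pi$-periodic function with $h(s)=|s-\pi|$ for $s\in[0,2\pi)$. For $\alpha>0$ let $T=T_3\circ T_2\circ T_1:\mathbb T^3\to\mathbb T^3$ with $$T_1(x,y,z)=(x+\alpha h(y),y,z),\quad T_2(x,y,z)=(x,y+\alpha h(z),z),\quad T_3(x,y,z)=(x,y,z+\alpha h(x)),$$ positions being taken modulo $2\pi$. $T$ is a volume-preserving bi-Lipschitz homeomorphism. With $\Sigma=\{0,\pi\}\subset\mathbb T$, its singular set is $\mathcal S=\{y\in\Sigma\}\cup\{z\in\Sigma\}\cup\{x+\alpha h(y)\in\Sigma\}$, and the regular set $\mathcal R=\mathbb T^3\setminus\bigcup_{m\in\mathbb Z}T^m(\mathcal S)$ is $T$-invariant and of full Lebesgue measure. For $n\in\mathbb Z$, $DT^n$ denotes the derivative of the iterate $T^n$. For all sufficiently large $\alpha$ there are constants $\Lambda_u,\Lambda_s>1$ (with $\Lambda_u$ of order $\alpha$ and $\Lambda_s$ of order $\alpha^3$), $\kappa>0$, and measurable families of linear subspaces $E^u(\boldsymbol x)$ of dimension $2$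 and $E^s(\boldsymbol x)$ of dimension $1$ of $\mathbb R^3$, $\boldsymbol x\in\mathcal R$, such that $\mathbb R^3=E^u(\boldsymbol x)\oplus E^s(\boldsymbol x)$, $DT(\boldsymbol x)E^{u}(\boldsymbol x)=E^{u}(T\boldsymbol x)$, $DT(\boldsymbol x)E^{s}(\boldsymbol x)=E^{s}(T\boldsymbol x)$, $|DT^n(\boldsymbol x)v|\ge\Lambda_u^n|v|$ for $v\in E^u(\boldsymbol x)$, $n\ge0$, $|DT^n(\boldsymbol x)v|\le\Lambda_s^{-n}|v|$ for $v\in E^s(\boldsymbol x)$, $n\ge0$, and $|v_u+v_s|\ge\kappa\max\{|v_u|,|v_s|\}$ for $v_u\in E^u(\boldsymbol x)$, $v_s\in E^s(\boldsymbol x)$. (These properties determine the splitting uniquely.) The $E^u$ in the claim is this family. Mean-free means $\int_{\mathbb T^3}B_0\,d\boldsymbol x=0$. *)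

(* Defs.v *)
From HB Require Import structures.
From mathcomp Require Import all_boot all_order all_algebra.
From mathcomp Require Import all_classical all_reals all_analysis.

Set Implicit Arguments.
Unset Strict Implicit.
Unset Printing Implicit Defensive.

Import Order.TTheory GRing.Theory Num.Theory.
Import numFieldNormedType.Exports.

Local Open Scope classical_set_scope.
Local Open Scope ring_scope.

(* The torus R^3 / (2 pi Z)^3 is handled through lifts to R^3: functions,
   vector fields and families of subspaces on the torus are (2 pi Z)^3-periodic
   ones on R^3 = 'rV[R]_3, subsets are invariant ones.  The maps T_1, T_2, T_3
   are given on R^3 by the same formulas as on the torus; they commute with the
   translations by (2 pi Z)^3, so the lift of T^m(S) is the image under the
   lift of T^m of the lift of S. *)

Section Torus.
Context {R : realType}.
Implicit Types (x v : 'rV[R]_3) (alpha : R).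

Definition vec3 (a b c : R) : 'rV[R]_3 := \row_(j < 3) [:: a; b; c]`_j.

Definition xc v : R := v 0 (0 : 'I_3).
Definition yc v : R := v 0 (1 : 'I_3).
Definition zc v : R := v 0 (2 : 'I_3).

(* The Euclidean norm; the library's norm on 'rV[R]_3 is the sup norm, and the
   expansion rates below are sensitive to the difference. *)
Definition enorm v : R := Num.sqrt (\sum_(i < 3) v 0 i ^+ 2).

Definition periodic_on (D : set 'rV[R]_3) (A : Type) (f : 'rV[R]_3 -> A) :=
  forall x (k : 'I_3 -> int), D x ->
    f (x + \row_i ((k i)%:~R * (2 * pi))) = f x.

Definition periodic (A : Type) (f : 'rV[R]_3 -> A) := periodic_on setT f.

(* The library's measures on R^3 are product measures, on triples. *)
Definition pt (p : measurableTypeR R * measurableTypeR R * measurableTypeR R) :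
  'rV[R]_3 := vec3 p.1.1 p.1.2 p.2.

Definition leb3 :
    {measure set (measurableTypeR R * measurableTypeR R * measurableTypeR R)
     -> \bar R} :=
  ((@lebesgue_measure R \x @lebesgue_measure R) \x @lebesgue_measure R)%E.

(* A fundamental domain: the integral over the torus is the one over it. *)
Definition cell :
    set (measurableTypeR R * measurableTypeR R * measurableTypeR R) :=
  `[0, 2 * pi[ `*` `[0, 2 * pi[ `*` `[0, 2 * pi[.

Definition h (s : R) : R :=
  `| (s - (Num.floor (s / (2 * pi)))%:~R * (2 * pi)) - pi |.

Definition T1 alpha x := vec3 (xc x + alpha * h (yc x)) (yc x) (zc x).
Definition T2 alpha x := vec3 (xc x) (yc x + alpha * h (zc x)) (zc x).
Definition T3 alpha x := vec3 (xc x) (yc x) (zc x + alpha * h (xc x)).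

Definition T alpha : 'rV[R]_3 -> 'rV[R]_3 := T3 alpha \o T2 alpha \o T1 alpha.

(* The lift to R of {0, pi}. *)
Definition Sigma : set R := [set s | exists k : int, s = k%:~R * pi].

Definition singular alpha : set 'rV[R]_3 :=
  [set x | Sigma (yc x) \/ Sigma (zc x) \/ Sigma (xc x + alpha * h (yc x))].

(* T^m(S) is an image for m >= 0 and a preimage for m <= 0. *)
Definition regular alpha : set 'rV[R]_3 :=
  ~` \bigcup_(m : nat) (iter m (T alpha) @` singular alpha `|`
                        iter m (T alpha) @^-1` singular alpha).

Definition DT alpha (n : nat) x : 'rV[R]_3 -> 'rV[R]_3 :=
  'd (iter n (T alpha)) x.

(* Spanned by k pointwise independent Borel fields on D. *)
Definition measurable_subspaces (D : set 'rV[R]_3) (k : nat)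
    (E : 'rV[R]_3 -> {vspace 'rV[R]_3}) :=
  exists e : 'rV[R]_3 -> k.-tuple 'rV[R]_3,
    (forall x, D x -> basis_of (E x) (e x)) /\
    (forall (i : 'I_k) (j : 'I_3),
       measurable_fun (pt @^-1` D) (fun p => tnth (e (pt p)) i 0 j)).

(* On the regular set these properties determine Eu and Es; values elsewhere
   are irrelevant. *)
Record hyperbolic_splitting alpha (Lu Ls kappa : R)
    (Eu Es : 'rV[R]_3 -> {vspace 'rV[R]_3}) : Prop := {
  Lu_gt1 : 1 < Lu;
  Ls_gt1 : 1 < Ls;
  kappa_gt0 : 0 < kappa;
  Eu_periodic : periodic_on (regular alpha) Eu;
  Es_periodic : periodic_on (regular alpha) Es;
  Eu_measurable : measurable_subspaces (regular alpha) 2%N Eu;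
  Es_measurable : measurable_subspaces (regular alpha) 1%N Es;
  Eu_dim : forall x, regular alpha x -> \dim (Eu x) = 2%N;
  Es_dim : forall x, regular alpha x -> \dim (Es x) = 1%N;
  EuEs_full : forall x, regular alpha x -> (Eu x + Es x = fullv)%VS;
  EuEs_direct : forall x, regular alpha x -> (Eu x :&: Es x = 0)%VS;
  Eu_invariant : forall x, regular alpha x ->
    (linfun (DT alpha 1%N x) @: Eu x)%VS = Eu (T alpha x);
  Es_invariant : forall x, regular alpha x ->
    (linfun (DT alpha 1%N x) @: Es x)%VS = Es (T alpha x);
  Eu_expand : forall x n v, regular alpha x -> v \in Eu x ->
    Lu ^+ n * enorm v <= enorm (DT alpha n x v);
  Es_contract : forall x n v, regular alpha x -> v \in Es x ->
    enorm (DT alpha n x v) <= Ls ^- n * enorm v;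
  EuEs_angle : forall x vu vs, regular alpha x -> vu \in Eu x -> vs \in Es x ->
    kappa * Num.max (enorm vu) (enorm vs) <= enorm (vu + vs)
}.

(* Borel representatives of elements of L^oo(torus; R^3); by periodicity the
   essential supremum may be taken over R^3. *)
Definition Linfty_field (B : 'rV[R]_3 -> 'rV[R]_3) :=
  periodic B /\
  forall i : 'I_3, measurable_fun setT (fun p => B (pt p) 0 i) /\
                   finite_norm leb3 +oo%E (fun p => B (pt p) 0 i).

Definition mean_free (B : 'rV[R]_3 -> 'rV[R]_3) :=
  forall i : 'I_3, (\int[leb3]_(p in cell) (B (pt p) 0 i)%:E = 0)%E.

Definition partial (i : 'I_3) (f : 'rV[R]_3 -> R) (x : 'rV[R]_3) : R :=
  'D_(delta_mx 0 i : 'rV[R]_3) f x.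

Definition smooth (f : 'rV[R]_3 -> R) :=
  forall (s : seq 'I_3) x, differentiable (foldr partial f s) x.

(* div B = 0 in the sense of distributions on the torus. *)
Definition div_free (B : 'rV[R]_3 -> 'rV[R]_3) :=
  forall phi : 'rV[R]_3 -> R, periodic phi -> smooth phi ->
    (\int[leb3]_(p in cell)
       (\sum_(i < 3) B (pt p) 0 i * partial i phi (pt p))%:E = 0)%E.

End Torus.

(* Main.v *)
From HB Require Import structures.
Require Import Defs.
From mathcomp Require Import all_boot all_order all_algebra.
From mathcomp Require Import measurable_realfun ess_sup_inf.
From mathcomp Require Import all_classical all_reals all_analysis.
From mathcomp Require Import ring lra.
Import Order.TTheory GRing.Theory Num.Theory.
Import numFieldNormedType.Exports.
Local Open Scope classical_set_scope.
Local Open Scope ring_scope.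
Set Implicit Arguments.
Unset Strict Implicit.
Unset Printing Implicit Defensive.

(** The map T is the third iterate of the shear U(x, y, z) = (y, z, x + al h(y)),
so the orbit of p under the inverse of U is encoded by one sequence of
coordinates: P_0 = z, P_1 = y, P_2 = x and P_{k+3} = P_k - al h(P_{k+2}).  Off
the planes where some P_k is in {0, pi}, the covectors dP_k satisfy the
linearised recursion and, for large al, grow like al^k along a single direction:
the component of dP_k along dx is of that order ([tang1_ge]), while the 2 x 2
minors of two consecutive covectors grow only like al^(k/2) ([minor_le]).  Hence
the normalised covector eta_n = dP_n / (dP_n/dx) converges exponentially fast
([slope_step]).  It is locally constant, and its limit annihilates E^u: a vector of
E^u is the image under the n-th iterate of T of a vector that is not longer, so
that dP_{3n+2} stays bounded on it whereas dP_{3n+2}/dx blows up ([Eu_slope]).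

As eta_n is locally constant, psi eta_n would have the curl (grad psi) x eta_n,
orthogonal to eta_n, but eta_n jumps across the planes above.  Take therefore
for psi_n the product over k < n of g_k(P_k), where the bump g_k : R -> [0, 1]
vanishes at multiples of pi and is close to 1 elsewhere.  Then
A_n = s psi_n eta_n, with s the sign h'(z), is Lipschitz
([lipschitz_bounded_pot]), and B_n = curl A_n = s (grad psi_n) x eta_n is
divergence free, mean free, and orthogonal to eta_n.

The difficulty is to pass to the limit, as grad psi_n grows like (4 al)^n, the
factor 4^n being the steepness of the bumps.  By the product rule, and since
dP_n x eta_n = 0, one has B_{n+1} = g_n(P_n) B_n + e_n where e_n only involves
eta_{n+1} - eta_n.  That difference decays like al^(-3n/2) and beats grad psi_n
once al^(1/2) is large compared with 4.  So |e_n| <= C / 2^n, and as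
0 <= g_n <= 1 the sequence B_n is bounded and converges everywhere
([perturbed_contraction_bound], [perturbed_contraction_cvg]).  The limit is a
bounded field, tangent to E^u ([field_vec_in_Eu]), and by dominated convergence
it is mean free and divergence free.

It is not zero because, integrating by parts, the second component of B_n
against h(z) has the integral - int psi_n ([limit_field_neq0]), and the bumps
are chosen so that 1 - g_k has an integral of size 2^(-k), which keeps
int psi_n away from zero ([cell_Rintegral_psi]).

All integrations by parts are instances of one identity for functions u and f
that are Lipschitz along the directions d and e, namely that d_d u d_e f and
d_e u d_d f have the same integral over the torus ([slope_swap]).  For
difference quotients it follows from the invariance of the integral under
translations, and dominated convergence gives it for the almost everywhere
derivatives, so that no smoothing is involved. *)

(** * Three-term recursions and perturbed contractions *)

Lemma nat_ind3 (Q : nat -> Prop) :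
  Q 0%N -> Q 1%N -> Q 2%N -> (forall n, Q n -> Q n.+1 -> Q n.+2 -> Q n.+3) ->
  forall n, Q n.
Proof.
move=> Q0 Q1 Q2 QS n.
suff [] : [/\ Q n, Q n.+1 & Q n.+2] by [].
by elim: n => [//|n [? ? ?]]; split => //; exact: QS.
Qed.

Section Recursion.
Context {R : realFieldType}.
Variables (al : R) (s : nat -> R).
Implicit Types d : R * R * R.

(** The differential of the n-th backward coordinate, applied to d = (x, y, z):
for [s n = h'(P_n)] this is the linearisation of P_{n+3} = P_n - al h(P_{n+2}). *)
Fixpoint tang d (n : nat) : R :=
  match n with
  | 0 => d.2
  | n1.+1 => match n1 with
    | 0 => d.1.2
    | n2.+1 => match n2 with
      | 0 => d.1.1
      | n3.+1 => tang d n3 - al * s n1 * tang d n1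
      end end end.

Lemma tangS d n : tang d n.+3 = tang d n - al * s n.+2 * tang d n.+2.
Proof. by []. Qed.

(** The value on (d, d') of the exterior product of two consecutive covectors. *)
Definition minor d d' n : R :=
  tang d n.+1 * tang d' n - tang d n * tang d' n.+1.

Hypothesis s1 : forall n, `|s n| = 1.

Lemma tang_le (b m : R) d : 1 <= b -> al + 1 = b ^+ 2 -> 0 <= al ->
  `|d.1.1| <= m -> `|d.1.2| <= m -> `|d.2| <= m ->
  forall n, `|tang d n| <= m * (b ^+ 2) ^+ n.
Proof.
move=> b1 bE al0 d1 d2 d3.
have m0 : 0 <= m by exact: le_trans (normr_ge0 _) d1.
have B1 : 1 <= b ^+ 2 by rewrite exprn_ege1.
elim/nat_ind3 => [|||n IH0 _ IH2].
- by rewrite expr0 mulr1.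
- by apply: (le_trans d2); rewrite ler_peMr ?exprn_ege1.
- by apply: (le_trans d1); rewrite ler_peMr ?exprn_ege1.
rewrite tangS; apply: (le_trans (ler_normB _ _)).
rewrite !normrM s1 mulr1 (ger0_norm al0) exprS mulrCA -bE mulrDl mul1r addrC.
apply: lerD; first by rewrite ler_wpM2l // mulrC; move: IH2; rewrite mulrC bE.
rewrite bE; apply: (le_trans IH0); apply: ler_wpM2l => //.
by apply: ler_weXn2l => //; rewrite -addn2 leq_addr.
Qed.

Let a := tang (1, 0, 0).

(** The linear recursion is dominated by the term al s_{n+2} tang_{n+2} as soon
as [a n] is not larger than [a n.+2], a property that the growth itself
propagates. *)
Lemma tang1_incr : 2 <= al -> forall n, (al - 1) * `|a n.+2| <= `|a n.+3|.
Proof.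
move=> al2.
have key n : `|a n| <= `|a n.+2| -> (al - 1) * `|a n.+2| <= `|a n.+3|.
  move=> h; rewrite /a tangS -/a distrC.
  apply: le_trans (lerB_dist _ _).
  by rewrite !normrM s1 mulr1 ger0_norm; lra.
have H n : `|a n| <= `|a n.+2| /\ `|a n.+1| <= `|a n.+2|.
  elim: n => [|n [h0 h1]]; first by rewrite /a/= normr0 normr1 ler01.
  have h2 : `|a n.+2| <= `|a n.+3|.
    by apply: le_trans (key n h0); rewrite ler_peMl //; lra.
  by split => //; exact: le_trans h2.
by move=> n; apply: key; case: (H n).
Qed.

Lemma tang1_ge : 2 <= al -> forall n, (al - 1) ^+ n <= `|a n.+2|.
Proof.
move=> al2; elim=> [|n IH]; first by rewrite expr0 /a/= normr1.
apply: le_trans (tang1_incr al2 n).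
by rewrite exprS ler_wpM2l //; lra.
Qed.

Lemma tang1_neq0 : 2 <= al -> forall n, a n.+2 != 0.
Proof.
move=> al2 n; rewrite -normr_gt0; apply: lt_le_trans (tang1_ge al2 n).
by apply: exprn_gt0; lra.
Qed.

Lemma minorS d d' n :
  minor d d' n.+3 = minor d d' n + al * s n.+2 * minor d d' n.+1.
Proof. rewrite /minor !tangS; ring. Qed.

(** In the recursion [minorS] the large coefficient al multiplies the term two
steps back, so the growth per step is the square root of al + 1. *)
Lemma minor_le (b : R) d d' : 1 <= b -> al + 1 = b ^+ 2 -> 0 <= al ->
  `|minor d d' 0| <= 1 -> `|minor d d' 1| <= 1 -> `|minor d d' 2| <= 1 ->
  forall n, `|minor d d' n| <= b ^+ n.
Proof.
move=> b1 bE al0 h0 h1 h2.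
elim/nat_ind3 => [//|||n IH0 IH1 _].
- by apply: (le_trans h1); rewrite exprn_ege1.
- by apply: (le_trans h2); rewrite exprn_ege1.
rewrite minorS; apply: (le_trans (ler_normD _ _)).
rewrite !normrM s1 mulr1 (ger0_norm al0).
have -> : b ^+ n.+3 = b ^+ n.+1 + al * b ^+ n.+1.
  by rewrite -[n.+3]add2n exprD -bE; ring.
apply: lerD; last by rewrite ler_wpM2l.
by apply: (le_trans IH0); apply: ler_weXn2l.
Qed.

(** The covector normalised to have x-component 1; a is [tang (1, 0, 0)]. *)
Definition slope d n : R := tang d n / a n.

(** The difference of two consecutive quotients is a minor over a product of
denominators: b^(n+2) against (al - 1)^(2n+1). *)
Lemma slope_step (b : R) d : 1 <= b -> al + 1 = b ^+ 2 -> 2 <= al ->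
  (forall n, `|minor d (1, 0, 0) n| <= b ^+ n) -> forall n,
  `|slope d n.+3 - slope d n.+2| <=
    b ^+ 2 / (al - 1) * (b / (al - 1) ^+ 2) ^+ n.
Proof.
move=> b1 bE al2 hm n.
have a2 := tang1_neq0 al2 n; have a3 := tang1_neq0 al2 n.+1.
have -> : slope d n.+3 - slope d n.+2 =
    minor d (1, 0, 0) n.+2 / (a n.+3 * a n.+2).
  by rewrite /slope /minor -/a; field; rewrite a2 a3.
have c0 : 0 < al - 1 by lra.
have b0 : 0 <= b by lra.
rewrite normrM normfV normrM.
have -> : b ^+ 2 / (al - 1) * (b / (al - 1) ^+ 2) ^+ n =
    b ^+ n.+2 * ((al - 1) ^+ n.+1 * (al - 1) ^+ n)^-1.
  rewrite expr_div_n -exprM mul2n -addnn exprD -[n.+2]add2n exprD [_ ^+ n.+1]exprS.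
  by field; rewrite !lt0r_neq0 // ?exprn_gt0.
apply: ler_pM; [exact: normr_ge0 | by rewrite invr_ge0 mulr_ge0 | exact: hm |].
rewrite lef_pV2 ?posrE; first last.
- by rewrite mulr_gt0 // exprn_gt0.
- by rewrite mulr_gt0 // normr_gt0.
have cn m : 0 <= (al - 1) ^+ m by rewrite exprn_ge0 // ltW.
by apply: ler_pM => //; exact: tang1_ge.
Qed.

End Recursion.

Lemma eq_tang {R : realFieldType} (al : R) (s s' : nat -> R) d n :
  (forall j, (j < n)%N -> s j = s' j) -> tang al s d n = tang al s' d n.
Proof.
elim/nat_ind3: n => [//|//|//|n IH0 IH1 IH2] e.
rewrite !tangS IH0 ?IH2 ?e // => j jn; apply: e; apply: ltn_trans jn _ => //.
by rewrite -addn3 -{1}[n]addn0 ltn_add2l.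
Qed.

Section PerturbedContraction.
Context {R : realType}.
Variables (y g e : nat -> R) (C : R).
Hypothesis yS : forall n, y n.+1 = g n * y n + e n.
Hypothesis g01 : forall n, 0 <= g n <= 1.
Hypothesis eC : forall n, `|e n| <= C / 2 ^+ n.

Let C0 : 0 <= C.
Proof. by have := eC 0%N; rewrite expr0 divr1; apply: le_trans. Qed.

(** A bounded defect of the form C / 2^n is absorbed by the correction
2 C / 2^n: |y_n| + 2 C / 2^n is nonincreasing. *)
Lemma perturbed_contraction_bound n : `|y n| <= `|y 0%N| + 2 * C.
Proof.
suff : `|y n| + 2 * C / 2 ^+ n <= `|y 0%N| + 2 * C.
  by apply: le_trans; rewrite lerDl mulr_ge0 ?invr_ge0 ?exprn_ge0 ?mulr_ge0.
elim: n => [|n]; first by rewrite expr0 divr1.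
apply: le_trans; rewrite yS.
have := ler_normD (g n * y n) (e n); rewrite normrM.
have := eC n; have /andP[g0 g1] := g01 n.
have -> : 2 * C / 2 ^+ n.+1 = C / 2 ^+ n.
  by rewrite exprS; field; rewrite expf_neq0.
have -> : 2 * C / 2 ^+ n = 2 * (C / 2 ^+ n) by rewrite mulrA.
have : `|g n| * `|y n| <= `|y n| by rewrite ger0_norm // ler_piMl.
lra.
Qed.

End PerturbedContraction.

Section PerturbedContractionCvg.
Context {R : realType}.

(* Multiplication by g_n in [0, 1] can only decrease the positive part of y_n, so
   that max (y_n, 0) + 2 C / 2^n is nonincreasing and nonnegative. *)
Let pos_part_cvg (y g e : nat -> R) (C : R) :
  (forall n, y n.+1 = g n * y n + e n) -> (forall n, 0 <= g n <= 1) ->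
  (forall n, `|e n| <= C / 2 ^+ n) ->
  cvgn (fun n => Num.max (y n) 0).
Proof.
move=> yS g01 eC.
have C0 : 0 <= C.
  by have := eC 0%N; rewrite expr0 divr1; apply: le_trans.
pose t n : R := 2 * C / 2 ^+ n.
have ct : t @ \oo --> (0 : R).
  have -> : t = (fun n => 2 * C * 2^-1 ^+ n).
    by apply/funext => n; rewrite /t exprVn.
  rewrite -(mulr0 (2 * C)); apply: cvgMr.
  by apply: cvg_expr; rewrite ger0_norm ?invr_ge0 // invf_lt1 // ltr1n.
have -> : (fun n => Num.max (y n) 0) = (fun n => (Num.max (y n) 0 + t n) - t n).
  by apply/funext => n; rewrite addrK.
apply: is_cvgB; last by apply/cvg_ex; exists 0.
apply: nonincreasing_is_cvgn.
  apply/nonincreasing_seqP => n.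
  have tS : t n.+1 = C / 2 ^+ n.
    by rewrite /t exprS; field; rewrite expf_neq0.
  have tE : t n = 2 * (C / 2 ^+ n) by rewrite /t mulrA.
  rewrite tS tE; have := eC n; rewrite ler_norml => /andP[e1 e2].
  have ge : Num.max (y n.+1) 0 <= Num.max (y n) 0 + C / 2 ^+ n.
    rewrite ge_max; apply/andP; split; last first.
      by rewrite addr_ge0 ?le_max ?lexx ?orbT // divr_ge0 // exprn_ge0.
    rewrite yS lerD //; have /andP[g0 g1] := g01 n.
    have [yn|yn] := leP 0 (y n).
      by rewrite ler_piMl.
    by rewrite nmulr_lle0.
  lra.
exists 0 => _ [n _ <-]; rewrite addr_ge0 ?le_max ?lexx ?orbT //.
by rewrite divr_ge0 ?mulr_ge0 ?exprn_ge0.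
Qed.

(** The products of the g_n may converge to any limit in [0, 1], so the sequence
need not be contracted to 0; the monotonicity of the corrected positive and
negative parts gives convergence all the same. *)
Lemma perturbed_contraction_cvg (y g e : nat -> R) (C : R) :
  (forall n, y n.+1 = g n * y n + e n) -> (forall n, 0 <= g n <= 1) ->
  (forall n, `|e n| <= C / 2 ^+ n) -> cvgn y.
Proof.
move=> yS g01 eC.
have -> : y = (fun n => Num.max (y n) 0 - Num.max (- y n) 0).
  by apply/funext => n; case: (leP (y n) 0) => h; case: (leP (- y n) 0) => h'; lra.
apply: is_cvgB; first exact: (pos_part_cvg yS g01 eC).
apply: (@pos_part_cvg (fun n => - y n) g (fun n => - e n) C) => //.
  by move=> n; rewrite yS opprD mulrN.
by move=> n; rewrite normrN.
Qed.

End PerturbedContractionCvg.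

(** * The triangle wave and the bumps *)

Section RealDerivatives.
Context {R : realType}.
Implicit Types (f g : R -> R) (a c k x : R).

Lemma is_derive_affine a c x : is_derive x 1 (fun t => a + c * t) c.
Proof.
have D := is_deriveD (is_derive_cst a x 1) (is_deriveZ c (is_derive_id x 1)).
by rewrite add0r [c *: 1]mulr1 in D; exact: D.
Qed.

Lemma is_derive_prod f g x a c : is_derive x 1 f a -> is_derive x 1 g c ->
  is_derive x 1 (fun t => f t * g t) (a * g x + f x * c).
Proof.
move=> Df Dg; have D := is_deriveM Df Dg.
by rewrite addrC [g x *: a]mulrC in D; exact: D.
Qed.

Lemma is_derive_subZ f g k x a c : is_derive x 1 f a -> is_derive x 1 g c ->
  is_derive x 1 (fun t => f t - k * g t) (a - k * c).
Proof. by move=> Df Dg; exact: (is_deriveB Df (is_deriveZ k Dg)). Qed.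

End RealDerivatives.

Section TriangleWave.
Context {R : realType}.
Local Notation pi := (@pi R).
Implicit Types s t M : R.

Definition frac2pi s : R := s - (Num.floor (s / (2 * pi)))%:~R * (2 * pi).

(** The derivative of [h] off {0, pi}, with the values of the right derivative
elsewhere. *)
Definition slope_sign s : R := if frac2pi s < pi then - 1 else 1.

Let pi0 : 0 < pi. Proof. exact: pi_gt0. Qed.

Lemma hE s : h s = `|frac2pi s - pi|. Proof. by []. Qed.

Lemma frac2pi_bounds s : 0 <= frac2pi s < 2 * pi.
Proof.
have p0 : 0 < 2 * pi by rewrite mulr_gt0.
have /andP[] := floor_itv (s / (2 * pi)).
rewrite ler_pdivlMr // ltr_pdivrMr // intrD => a b.
by rewrite /frac2pi; apply/andP; split; lra.
Qed.

Lemma frac2pi_def s (m : int) : 0 <= s - m%:~R * (2 * pi) < 2 * pi ->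
  frac2pi s = s - m%:~R * (2 * pi).
Proof.
have p0 : 0 < 2 * pi by rewrite mulr_gt0.
move=> /andP[a b]; rewrite /frac2pi (@floor_def _ _ m) //.
rewrite ler_pdivlMr // ltr_pdivrMr // intrD.
by apply/andP; split; lra.
Qed.

Lemma frac2piD s (m : int) : frac2pi (s + m%:~R * (2 * pi)) = frac2pi s.
Proof.
rewrite (@frac2pi_def _ (Num.floor (s / (2 * pi)) + m)).
  by rewrite intrD /frac2pi; ring.
rewrite (_ : _ - _ = frac2pi s); first exact: frac2pi_bounds.
by rewrite intrD /frac2pi; ring.
Qed.

Lemma hD s (m : int) : h (s + m%:~R * (2 * pi)) = h s.
Proof. by rewrite !hE frac2piD. Qed.

Lemma slope_signD s (m : int) : slope_sign (s + m%:~R * (2 * pi)) = slope_sign s.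
Proof. by rewrite /slope_sign frac2piD. Qed.

Lemma slope_sign_pm s : slope_sign s = 1 \/ slope_sign s = - 1.
Proof. by rewrite /slope_sign; case: ifP => _; [right|left]. Qed.

Lemma normr_slope_sign s : `|slope_sign s| = 1.
Proof. by case: (slope_sign_pm s) => ->; rewrite ?normrN normr1. Qed.

Lemma slope_sign_sq s : slope_sign s * slope_sign s = 1.
Proof. by case: (slope_sign_pm s) => ->; rewrite ?mulrNN mulr1. Qed.

Lemma h_ge0 s : 0 <= h s. Proof. exact: normr_ge0. Qed.

Lemma h_le_pi s : h s <= pi.
Proof.
have /andP[a b] := frac2pi_bounds s.
by rewrite hE ler_norml; apply/andP; split; lra.
Qed.

(* h is the pointwise maximum of the tents pi - |s - 2 k pi|, whence its
   Lipschitz bound. *)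
Let tent_le_h s (m : int) : pi - `|s - m%:~R * (2 * pi)| <= h s.
Proof.
rewrite hE; have /andP[a b] := frac2pi_bounds s.
have -> : s - m%:~R * (2 * pi) =
    frac2pi s + (Num.floor (s / (2 * pi)) - m)%:~R * (2 * pi).
  by rewrite intrB /frac2pi; ring.
set n : int := (_ - m)%R.
have [n0|n0|->] := ltgtP n 0.
- have : (n + 1)%:~R <= 0 :> R by rewrite lerz0 lezD1.
  rewrite intrD => n1.
  have : n%:~R * (2 * pi) <= - (2 * pi).
    by rewrite -[leRHS]mulN1r ler_pM2r ?mulr_gt0 //; lra.
  have := ler_norm (frac2pi s - pi).
  have := ler_norm (- (frac2pi s + n%:~R * (2 * pi))); rewrite normrN; lra.
- have : 1 <= n%:~R :> R by rewrite ler1z -gtz0_ge1.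
  move=> n1; have : 2 * pi <= n%:~R * (2 * pi).
    by rewrite -[leLHS]mul1r ler_pM2r ?mulr_gt0 //; lra.
  have := normr_ge0 (frac2pi s - pi).
  have := ler_norm (frac2pi s + n%:~R * (2 * pi)); lra.
rewrite mul0r addr0 ger0_norm //.
by have := ler_norm (- (frac2pi s - pi)); rewrite normrN; lra.
Qed.

Let tent_eq_h s : exists m : int, h s = pi - `|s - m%:~R * (2 * pi)|.
Proof.
have /andP[a b] := frac2pi_bounds s; pose m := Num.floor (s / (2 * pi)).
have [lt|ge] := leP (frac2pi s) pi.
  exists m; rewrite -/(frac2pi s) hE ler0_norm ?subr_le0 // ger0_norm //; lra.
exists (m + 1).
have -> : s - (m + 1)%:~R * (2 * pi) = frac2pi s - 2 * pi.
  by rewrite intrD /frac2pi -/m; ring.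
by rewrite hE ger0_norm ?subr_ge0 1?ltW // ler0_norm; lra.
Qed.

Lemma h_lipschitz s t : `|h s - h t| <= `|s - t|.
Proof.
have H (u v : R) : h u - h v <= `|u - v|.
  have [m ->] := tent_eq_h u; have := tent_le_h v m.
  have := ler_distD u v (m%:~R * (2 * pi)); rewrite (distrC v u); lra.
rewrite ler_norml; apply/andP; split; last exact: H.
by have := H t s; rewrite distrC; lra.
Qed.

(** The distance of s to the corners of h is the minimum of h s and pi - h s;
within that distance h is affine. *)
Lemma h_local s t : `|t - s| < h s -> `|t - s| < pi - h s ->
  h t = h s + slope_sign s * (t - s) /\ slope_sign t = slope_sign s.
Proof.
have /andP[a b] := frac2pi_bounds s.
pose m := Num.floor (s / (2 * pi)).
have ts : t - m%:~R * (2 * pi) = frac2pi s + (t - s) by rewrite /frac2pi -/m; ring.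
rewrite !hE /slope_sign; case: (ltP (frac2pi s) pi) => fs.
  have -> : `|frac2pi s - pi| = pi - frac2pi s by rewrite ler0_norm; lra.
  move=> h1 h2.
  move: h1 h2; rewrite !ltr_norml => /andP[h1 h2] /andP[h3 h4].
  have ft : frac2pi t = frac2pi s + (t - s).
    by rewrite (@frac2pi_def _ m) ts //; apply/andP; split; lra.
  rewrite ft ler0_norm; last lra.
  by split; [ring | rewrite ifT //; lra].
have -> : `|frac2pi s - pi| = frac2pi s - pi by rewrite ger0_norm; lra.
move=> h1 h2.
move: h1 h2; rewrite !ltr_norml => /andP[h1 h2] /andP[h3 h4].
have ft : frac2pi t = frac2pi s + (t - s).
  by rewrite (@frac2pi_def _ m) ts //; apply/andP; split; lra.
rewrite ft ger0_norm; last lra.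
by split; [ring | rewrite ifF //; apply/negbTE; rewrite -leNgt; lra].
Qed.

Lemma h_interior s : ~ Sigma s -> 0 < h s < pi.
Proof.
move=> nS; have /andP[a b] := frac2pi_bounds s.
have e2 (m : int) : (2 * m)%:~R * pi = m%:~R * (2 * pi) by rewrite intrM; ring.
have e3 (m : int) : (2 * m + 1)%:~R * pi = m%:~R * (2 * pi) + pi.
  by rewrite intrD intrM; ring.
rewrite !lt_neqAle h_ge0 h_le_pi !andbT; apply/andP; split; apply/negP => /eqP.
  move=> /esym; rewrite hE => /normr0_eq0 e; apply: nS.
  exists (2 * Num.floor (s / (2 * pi)) + 1).
  by move: e; rewrite /frac2pi e3; lra.
move=> e; apply: nS; exists (2 * Num.floor (s / (2 * pi))).
suff : frac2pi s = 0 by rewrite /frac2pi e2; lra.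
by move: e; rewrite hE; case: ger0P => h0 e; lra.
Qed.

Lemma h_near s : ~ Sigma s ->
  \forall t \near s, h t = h s + slope_sign s * (t - s) /\
                     slope_sign t = slope_sign s.
Proof.
move=> /h_interior /andP[h0 h1].
have d0 : 0 < Num.min (h s) (pi - h s) by rewrite lt_min h0 subr_gt0.
near=> t.
have : `|t - s| < Num.min (h s) (pi - h s).
  by rewrite distrC; near: t; exact: nbhsx_ballx.
by rewrite lt_min => /andP[? ?]; exact: h_local.
Unshelve. all: by end_near. Qed.

Lemma h_is_derive s : ~ Sigma s -> is_derive s 1 h (slope_sign s).
Proof.
move=> nS.
have D := is_derive_affine (h s - slope_sign s * s) (slope_sign s) s.
apply: (near_eq_is_derive _ D); apply: filterS (h_near nS) => t [-> _].
by ring.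
Qed.

End TriangleWave.

Section Bump.
Context {R : realType}.
Local Notation pi := (@pi R).
Implicit Types s t M : R.

(** On a period, [well] is the product of the distances to the even and to the
odd multiples of pi; it vanishes exactly on the corners of [h]. *)
Definition well s : R := h s * (pi - h s).

(** A weight in [0, 1] that vanishes on the corners of [h] and tends to 1 elsewhere
as M grows; a rational function of the well makes its derivative explicit. *)
Definition bump M s : R := M * well s / (1 + M * well s).

Definition dbump M s : R :=
  M * (slope_sign s * (pi - 2 * h s)) / (1 + M * well s) ^+ 2.

Let pi0 : 0 < pi. Proof. exact: pi_gt0. Qed.

Lemma well_ge0 s : 0 <= well s.
Proof. by rewrite /well mulr_ge0 ?h_ge0 // subr_ge0 h_le_pi. Qed.

Lemma well_lipschitz s t : `|well s - well t| <= pi * `|s - t|.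
Proof.
have -> : well s - well t = (pi - h s - h t) * (h s - h t).
  by rewrite /well; ring.
rewrite normrM; apply: ler_pM => //; last exact: h_lipschitz.
have := h_ge0 s; have := h_ge0 t; have := h_le_pi s; have := h_le_pi t.
by move=> *; rewrite ler_norml; apply/andP; split; lra.
Qed.

(** Between two points where [slope_sign] differs there is a corner of h, where
the well vanishes.  This is what makes a bump times the sign Lipschitz. *)
Lemma well_sign_jump s t : slope_sign s != slope_sign t -> well s <= pi * `|s - t|.
Proof.
move=> ne; rewrite /well; have := h_ge0 s; have := h_le_pi s => h1 h0.
have [l1|g1] := leP (h s) `|s - t|.
  by rewrite mulrC; apply: ler_pM => //; lra.
have [l2|g2] := leP (pi - h s) `|s - t|; first by apply: ler_pM => //; lra.
case: (@h_local _ s t); rewrite ?(distrC t s) // => _ e.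
by rewrite e eqxx in ne.
Qed.

Lemma bump_den_gt0 M s : 0 <= M -> 0 < 1 + M * well s.
Proof. by move=> M0; have := mulr_ge0 M0 (well_ge0 s); lra. Qed.

Lemma bumpE M s : 0 <= M -> 1 - bump M s = (1 + M * well s)^-1.
Proof.
by move=> M0; rewrite /bump; field; rewrite gt_eqF // bump_den_gt0.
Qed.

Lemma bump_ge0 M s : 0 <= M -> 0 <= bump M s.
Proof.
move=> M0; apply: divr_ge0; first by rewrite mulr_ge0 // well_ge0.
exact/ltW/bump_den_gt0.
Qed.

Lemma bump_le1 M s : 0 <= M -> bump M s <= 1.
Proof.
by move=> M0; rewrite -subr_ge0 bumpE // invr_ge0; exact/ltW/bump_den_gt0.
Qed.

Lemma bump_le_well M s : 0 <= M -> bump M s <= M * well s.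
Proof.
move=> M0; rewrite ler_pdivrMr ?bump_den_gt0 // ler_peMr //.
  by rewrite mulr_ge0 // well_ge0.
by rewrite lerDl mulr_ge0 // well_ge0.
Qed.

Lemma bump_lipschitz M s t : 0 <= M ->
  `|bump M s - bump M t| <= M * pi * `|s - t|.
Proof.
move=> M0; have ds := bump_den_gt0 s M0; have dt := bump_den_gt0 t M0.
have -> : bump M s - bump M t =
    M * (well s - well t) * ((1 + M * well s) * (1 + M * well t))^-1.
  by rewrite /bump; field; rewrite !gt_eqF.
rewrite normrM normrM (ger0_norm M0) -mulrA -(mulrA M).
rewrite ler_wpM2l // -[leRHS]mulr1; apply: ler_pM => //.
  exact: well_lipschitz.
have dd := mulr_gt0 ds dt; rewrite normfV (gtr0_norm dd) invf_le1 //.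
rewrite -[leLHS]mulr1; apply: ler_pM => //; by rewrite lerDl mulr_ge0 ?well_ge0.
Qed.

Lemma bump_sign_lipschitz M s t : 0 <= M ->
  `|bump M s * slope_sign s - bump M t * slope_sign t| <=
    2 * (M * pi) * `|s - t|.
Proof.
move=> M0.
have e0 : 0 <= M * pi * `|s - t| by rewrite !mulr_ge0 // ltW.
have [->|ne] := eqVneq (slope_sign s) (slope_sign t).
  rewrite -mulrBl normrM normr_slope_sign mulr1.
  by apply: le_trans (bump_lipschitz s t M0) _; lra.
apply: le_trans (ler_normB _ _) _.
rewrite (normrM (bump M s)) (normrM (bump M t)) !normr_slope_sign !mulr1.
have H u v : slope_sign u != slope_sign v -> `|bump M u| <= M * pi * `|u - v|.
  move=> uv; rewrite ger0_norm ?bump_ge0 //.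
  apply: le_trans (bump_le_well u M0) _.
  by rewrite -mulrA ler_wpM2l // well_sign_jump.
have := H _ _ ne; have := H t s; rewrite eq_sym => /(_ ne).
by rewrite (distrC t s); lra.
Qed.

Lemma dbump_le M s : 0 <= M -> `|dbump M s| <= M * pi.
Proof.
move=> M0; rewrite /dbump normrM normrM normrM normr_slope_sign mul1r.
rewrite (ger0_norm M0) -mulrA ler_wpM2l // -[leRHS]mulr1; apply: ler_pM => //.
  have := h_ge0 s; have := h_le_pi s => h1 h0.
  by rewrite ler_norml; apply/andP; split; lra.
have dd := exprn_gt0 2 (bump_den_gt0 s M0).
rewrite normfV (gtr0_norm dd) invf_le1 // exprn_ege1 //.
by rewrite lerDl mulr_ge0 ?well_ge0.
Qed.

Lemma bumpD M s (m : int) : bump M (s + m%:~R * (2 * pi)) = bump M s.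
Proof. by rewrite /bump /well !hD. Qed.

Lemma dbumpD M s (m : int) : dbump M (s + m%:~R * (2 * pi)) = dbump M s.
Proof. by rewrite /dbump /well !hD slope_signD. Qed.

Lemma bump_is_derive M s : 0 <= M -> ~ Sigma s ->
  is_derive s 1 (bump M) (dbump M s).
Proof.
move=> M0 nS; have dh := h_is_derive nS.
have dw : is_derive s 1 (fun t => 1 + M * well t)
    (M * (slope_sign s * (pi - 2 * h s))).
  have dpi := is_derive_subZ 1 (is_derive_cst (pi : R) s 1) dh.
  have d1 := is_derive_subZ (- M) (is_derive_cst (1 : R) s 1) (is_derive_prod dh dpi).
  rewrite (_ : (fun t => _) = fun t => cst 1 t - - M * (h t * (cst pi t - 1 * h t))).
    rewrite (_ : M * _ = 0 - - M * (slope_sign s * (cst pi s - 1 * h s) +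
      h s * (0 - 1 * slope_sign s))) //.
    by rewrite /cst; ring.
  by apply/funext => t; rewrite /well /cst; ring.
have n0 : 1 + M * well s != 0 by rewrite gt_eqF // bump_den_gt0.
have dv := is_derive_subZ 1 (is_derive_cst (1 : R) s 1)
  (is_deriveV (f := fun t => 1 + M * well t) n0 dw).
rewrite (_ : bump M = fun t => cst 1 t - 1 * (1 + M * well t)^-1).
  rewrite (_ : dbump M s = 0 - 1 * (- (1 + M * well s) ^- 2 *:
    (M * (slope_sign s * (pi - 2 * h s))))) //.
  by rewrite /dbump /GRing.scale /=; field.
by apply/funext => t; rewrite mul1r -bumpE // subKr.
Qed.

End Bump.

Section BumpMeasure.
Context {R : realType}.
Local Notation pi := (@pi R).
Local Notation mR := (measurableTypeR R).
Local Notation mu := (@lebesgue_measure R).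
Implicit Types s t M : R.

Let pi0 : 0 < pi. Proof. exact: pi_gt0. Qed.

Lemma lipschitz_measurable (f : R -> R) (L : R) :
  (forall s t, `|f s - f t| <= L * `|s - t|) ->
  measurable_fun [set: mR] (f : mR -> mR).
Proof.
move=> fL; have L0 : 0 <= L.
  by have := le_trans (normr_ge0 _) (fL 1 0); rewrite subr0 normr1 mulr1.
suff cf : continuous f by exact: continuous_measurable_fun.
move=> s.
apply/cvgrPdist_lt => e e0.
have e'0 : 0 < e / (L + 1) by rewrite divr_gt0 // ltr_wpDl.
near=> t; apply: le_lt_trans (fL _ _) _.
apply: (@le_lt_trans _ _ ((L + 1) * `|s - t|)).
  by rewrite ler_wpM2r // lerDl.
rewrite mulrC -ltr_pdivlMr; last by rewrite ltr_wpDl.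
by near: t; exists (e / (L + 1)).
Unshelve. all: by end_near. Qed.

Lemma measurable_h : measurable_fun [set: mR] (@h R : mR -> mR).
Proof.
by apply: (@lipschitz_measurable _ 1) => s t; rewrite mul1r h_lipschitz.
Qed.

Lemma measurable_slope_sign : measurable_fun [set: mR] (@slope_sign R : mR -> mR).
Proof.
have mfl : measurable_fun [set: mR] ((fun s => (Num.floor s)%:~R) : mR -> mR).
  by apply: nondecreasing_measurable => // s t; rewrite ler_int; exact: le_floor.
apply: measurable_fun_ifT => //; apply: measurable_fun_ltr => //.
apply: measurable_funB => //; apply: measurable_funM => //.
by apply: (measurableT_comp mfl); exact: measurable_funM.
Qed.

Lemma measurable_bump M : 0 <= M -> measurable_fun [set: mR] (bump M : mR -> mR).
Proof. by move=> M0; apply: lipschitz_measurable => s t; exact: bump_lipschitz. Qed.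

Lemma measurable_dbump M : 0 <= M ->
  measurable_fun [set: mR] (dbump M : mR -> mR).
Proof.
move=> M0; rewrite (_ : dbump M = fun s : mR =>
  M * (slope_sign s * (pi - 2 * h s)) * (1 - bump M s) ^+ 2); last first.
  by apply/funext => s; rewrite bumpE // exprVn.
apply: measurable_funM.
  apply: measurable_funM => //; apply: measurable_funM.
    exact: measurable_slope_sign.
  by apply: measurable_funB => //; apply: measurable_funM => //; exact: measurable_h.
apply: measurable_funX; apply: measurable_funB => //; exact: measurable_bump.
Qed.

Definition near_Sigma (d : R) : set mR :=
  `[0, d] `|` `[pi - d, pi + d] `|` `[2 * pi - d, 2 * pi].

(* Off the d-neighbourhood of the corners one of the two factors of the well is
   at least d and the other at least 1, because pi >= 2. *)
Let well_lower s d : 0 <= s < 2 * pi -> 0 <= d -> ~ near_Sigma d s -> d <= well s.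
Proof.
move=> /andP[s0 s1] d0 ns.
have fE : frac2pi s = s by rewrite (@frac2pi_def _ s 0) mul0r subr0 // s0.
have p1 : 2 <= pi := pi_ge2 R.
have l0 : d <= s.
  rewrite leNgt; apply/negP => sd; apply: ns; left; left => /=.
  by rewrite in_itv /= s0 ltW.
have l3 : s <= 2 * pi - d.
  rewrite leNgt; apply/negP => sd; apply: ns; right => /=.
  by rewrite in_itv /=; apply/andP; split; lra.
have [lt|gt] := leP (s) pi.
  have l1 : s <= pi - d.
    rewrite leNgt; apply/negP => sd; apply: ns; left; right => /=.
    by rewrite in_itv /=; apply/andP; split; lra.
  have -> : well s = s * (pi - s).
    by rewrite /well hE fE ler0_norm ?subr_le0 //; ring.
  have [|] := leP s 1 => h1.
    by have := ler_pM d0 _ l0 (_ : 1 <= pi - s); rewrite mulr1; apply; lra.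
  by have := ler_pM _ d0 (_ : 1 <= s) (_ : d <= pi - s); rewrite mul1r; apply; lra.
have l2 : pi + d <= s.
  rewrite leNgt; apply/negP => sd; apply: ns; left; right => /=.
  by rewrite in_itv /=; apply/andP; split; lra.
have -> : well s = (s - pi) * (2 * pi - s).
  by rewrite /well hE fE ger0_norm ?subr_ge0 1?ltW //; ring.
have [|] := leP (s - pi) 1 => h1.
  by have := ler_pM d0 _ (_ : d <= s - pi) (_ : 1 <= 2 * pi - s); rewrite mulr1; apply; lra.
by have := ler_pM _ d0 (_ : 1 <= s - pi) (_ : d <= 2 * pi - s); rewrite mul1r; apply; lra.
Qed.

Let measurable_near d : measurable (near_Sigma d).
Proof. by apply: measurableU => //; exact: measurableU. Qed.

Let near_measure d : 0 <= d -> (mu (near_Sigma d) <= (4 * d)%:E)%E.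
Proof.
move=> d0.
have itv_le (a b c : R) : b - a = c -> 0 <= c -> (mu `[a, b] <= c%:E)%E.
  by move=> <- c0; rewrite lebesgue_measure_itv /= lte_fin; case: ifP.
apply: le_trans (measureU2 _ _ _) _ => //; first exact: measurableU.
have -> : (4 * d = (d + 2 * d) + d) by ring.
rewrite (EFinD (_ + _)); apply: leeD; last by apply: itv_le; lra.
apply: le_trans (measureU2 _ _ _) _ => //.
by rewrite EFinD; apply: leeD; apply: itv_le; lra.
Qed.

(** The defect is at most 1 on the 1/m-neighbourhood of the corners, of measure at
most 4 / m, and at most 1 / (1 + m^2 / m) outside it, on a period of length at
most 8. *)
Lemma bump_defect_integral (m : R) : 0 < m ->
  (\int[mu]_(s in `[0%R, (2 * pi)%R[) (1 - bump (m ^+ 2) s)%:E <= (12 / m)%:E)%E.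
Proof.
move=> m0.
have M0 : 0 <= m ^+ 2 by rewrite exprn_ge0 // ltW.
pose d : R := m^-1; have d0 : 0 <= d by rewrite invr_ge0 ltW.
have mD : measurable (`[0, (2 * pi)[ : set mR) by exact: measurable_itv.
have F0 s : (0 <= (1 - bump (m ^+ 2) s)%:E)%E by rewrite lee_fin subr_ge0 bump_le1.
have c0 : 0 <= m^-1 := d0.
have mind : measurable_fun `[0, 2 * pi[ (fun s : mR => (\1_(near_Sigma d) s)%:E : \bar R).
  by apply/measurable_EFinP/measurable_indic; exact: measurable_near.
apply: (@le_trans _ _ (\int[mu]_(s in `[0%R, (2 * pi)%R[)
    ((\1_(near_Sigma d) s)%:E + m^-1%:E))%E).
  apply: ge0_le_integral => //.
  - apply/measurable_EFinP; apply: measurable_funB => //.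
    by apply: measurable_funTS; exact: measurable_bump.
  - by apply: emeasurable_funD.
  move=> s /=; rewrite in_itv /= => s01; rewrite -EFinD lee_fin.
  rewrite indicE; case: (boolP (s \in near_Sigma d)) => /= sN.
    by have := bump_ge0 s M0; lra.
  rewrite add0r bumpE //.
  have ws : d <= well s by apply: well_lower => // sN'; move/negP: sN; apply; rewrite inE.
  rewrite lef_pV2 ?posrE ?bump_den_gt0 //.
  have : m <= m ^+ 2 * well s.
    have e : m ^+ 2 * d = m by rewrite /d expr2 mulfK // gt_eqF.
    by rewrite -[leLHS]e ler_wpM2l.
  by move=> ?; rewrite ler_wpDl.
rewrite ge0_integralD //.
rewrite integral_indic // integral_cst //= lebesgue_measure_itv /= lte_fin mulr_gt0 //.
rewrite -EFinD -EFinM oppr0 addr0.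
have -> : 12 / m = 4 * d + m^-1 * 8 by rewrite /d; field; rewrite gt_eqF.
rewrite EFinD; apply: leeD.
  apply: le_trans (near_measure d0); apply: le_measure; rewrite ?inE //.
  exact: measurableI.
rewrite lee_fin ler_wpM2l //; have := pihalf_lt2 R; lra.
Qed.

End BumpMeasure.

(** * Integration over the periodicity cell *)

Section PeriodicIntegral.
Context {R : realType}.
Local Notation pi := (@pi R).
Local Notation mR := (measurableTypeR R).
Local Notation mu := (@lebesgue_measure R).
Local Open Scope ereal_scope.

Definition periodic1 (u : mR -> \bar R) :=
  forall (s : R) (m : int), u (s + m%:~R * (2 * pi))%R = u s.

Let pi0 : (0 < pi)%R. Proof. exact: pi_gt0. Qed.

Let measurable_add (c : R) : measurable_fun [set: mR] ((fun s => s + c)%R : mR -> mR).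
Proof. exact: measurable_funD. Qed.

Lemma lebesgue_measure_translation (c : R) (A : set mR) : measurable A ->
  pushforward mu ((fun s => s + c)%R : mR -> mR) A = mu A.
Proof.
move=> mA; apply/esym; apply: (lebesgue_measure_unique
  (mu := pushforward mu ((fun s => s + c)%R : mR -> mR))) => // _ [[a b]] _ <-.
rewrite -[RHS]/(mu ((fun s : R => s + c)%R @^-1` `]a, b]%classic)).
rewrite [X in _ = _ X](_ : _ = `](a - c)%R, (b - c)%R]%classic); last first.
  apply/seteqP; split => s /=; rewrite !in_itv /= => /andP[? ?];
  by apply/andP; split; lra.
rewrite !lebesgue_measure_itv /= !lte_fin ltrD2r.
by case: ifP => // _; rewrite -!EFinD; congr (_%:E); ring.
Qed.

Lemma ge0_integral_translation (u : mR -> \bar R) (c : R) (D : set mR) :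
  measurable D -> measurable_fun D u -> (forall s, 0 <= u s) ->
  \int[mu]_(s in (fun s => s + c)%R @^-1` D) u (s + c)%R = \int[mu]_(s in D) u s.
Proof.
move=> mD meu u0; rewrite -[LHS](ge0_integral_pushforward (measurable_add c)) //.
apply: eq_measure_integral => //= A mA _; exact: lebesgue_measure_translation.
Qed.

(** With the translation c reduced modulo 2 pi to d in [0, 2 pi[, the shifted
period is cut at 2 pi and its last piece is moved back by periodicity. *)
Lemma periodic_integral_translation (u : mR -> \bar R) (c : R) :
  measurable_fun setT u -> (forall s, 0 <= u s) -> periodic1 u ->
  \int[mu]_(s in `[0%R, (2 * pi)%R[) u (s + c)%R =
  \int[mu]_(s in `[0%R, (2 * pi)%R[) u s.
Proof.
move=> meu u0 up.
pose m := Num.floor (c / (2 * pi)); pose d := frac2pi c.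
have dE : c = (d + m%:~R * (2 * pi))%R by rewrite /d /frac2pi; ring.
have /andP[d0 d1] := frac2pi_bounds c.
transitivity (\int[mu]_(s in `[0%R, (2 * pi)%R[) u (s + d)%R).
  by apply: eq_integral => s _; rewrite [in LHS]dE addrA up.
have muS D : measurable_fun D u by apply: measurable_funTS.
transitivity (\int[mu]_(s in `[d, (2 * pi + d)%R[) u s).
  rewrite -(@ge0_integral_translation u d) //.
  congr integral; apply/seteqP; split => s /=; rewrite !in_itv /= => /andP[? ?];
  by apply/andP; split; lra.
rewrite (_ : `[d, (2 * pi + d)%R[%classic =
    `[d, (2 * pi)%R[%classic `|` `[(2 * pi)%R, (2 * pi + d)%R[%classic); last first.
  rewrite -itv_bndbnd_setU // bnd_simp; rewrite /d; lra.
rewrite ge0_integral_setU //; last first.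
  apply/disj_setPS => s [] /=; rewrite !in_itv /= => /andP[_ ?] /andP[? _]; lra.
rewrite [X in _ + X](_ : _ = \int[mu]_(s in `[0%R, d[) u s); last first.
  rewrite -(@ge0_integral_translation u (2 * pi)%R
    `[(2 * pi)%R, (2 * pi + d)%R[%classic) //.
  transitivity (\int[mu]_(s in `[0%R, d[) u (s + (1%:~R : R) * (2 * pi))%R).
    rewrite mulr1z mul1r; congr integral; apply/seteqP; split => s /=;
    rewrite !in_itv /= => /andP[? ?]; by apply/andP; split; lra.
  by apply: eq_integral => s _; rewrite up.
rewrite addeC -ge0_integral_setU //; last first.
  apply/disj_setPS => s [] /=; rewrite !in_itv /= => /andP[_ ?] /andP[? _]; lra.
rewrite -itv_bndbnd_setU // bnd_simp; rewrite /d; lra.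
Qed.

End PeriodicIntegral.

Section PlaneMeasure.
Context {R : realType}.
Local Notation mR := (measurableTypeR R).
Local Notation mu := (@lebesgue_measure R).

(** The inner factor of [leb3]; Tonelli's theorem needs it as a sigma-finite
measure of its own. *)
Definition leb2 : set (mR * mR)%type -> \bar R := (mu \x mu)%E.

HB.instance Definition _ := Measure.copy leb2 (mu \x mu)%E.

Let square (n : nat) : set (mR * mR)%type :=
  `[- n%:R, n%:R] `*` `[- n%:R, n%:R].

Let leb2_sigma_finite : sigma_finite setT leb2.
Proof.
exists square.
  apply/seteqP; split => // -[x y] _.
  pose m := Num.truncn (Num.max `|x| `|y|); exists m.+1 => //.
  have : Num.max `|x| `|y| < m.+1%:R by rewrite truncnS_gt.
  rewrite gt_max !ltr_norml => /andP[/andP[a b] /andP[c d]].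
  by split; rewrite /= in_itv /= !ltW.
move=> n; split; first exact: measurableX.
have fin : (mu (`[(- n%:R)%R, n%:R] : set mR) < +oo)%E.
  by rewrite lebesgue_measure_itv /=; case: ifP => _; rewrite ?ltry.
rewrite /leb2 product_measure1E //.
by apply: lte_mul_pinfty => //; rewrite ge0_fin_numE.
Qed.

HB.instance Definition _ := Measure_isSigmaFinite.Build _ _ _ leb2
  leb2_sigma_finite.

End PlaneMeasure.

Section TripleIntegral.
Context {R : realType}.
Local Notation mR := (measurableTypeR R).
Local Notation mu := (@lebesgue_measure R).
Local Notation X3 := (mR * mR * mR)%type.
Local Open Scope ereal_scope.
Implicit Types (G : X3 -> \bar R) (f : mR * mR -> mR).

Lemma measurable_px : measurable_fun [set: X3] (fun p : X3 => p.1.1).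
Proof. exact: (measurableT_comp measurable_fst). Qed.

Lemma measurable_py : measurable_fun [set: X3] (fun p : X3 => p.1.2).
Proof. exact: (measurableT_comp measurable_snd). Qed.

Lemma measurable_pz : measurable_fun [set: X3] (fun p : X3 => p.2).
Proof. exact: measurable_snd. Qed.

(** Rotations of the coordinates and shears of the last one generate all the maps
used below, so these are the only changes of variables to be proved. *)
Definition rotate (p : X3) : X3 := (p.2, p.1.1, p.1.2).

Lemma measurable_rotate : measurable_fun setT rotate.
Proof.
apply: measurable_fun_pair; last exact: measurable_py.
by apply: measurable_fun_pair; [exact: measurable_pz | exact: measurable_px].
Qed.

Lemma integral_rotate G : measurable_fun setT G -> (forall p, 0 <= G p) ->
  \int[leb3]_p G (rotate p) = \int[leb3]_p G p.
Proof.
move=> mG G0; have mGr : measurable_fun setT (G \o rotate).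
  exact: measurableT_comp mG measurable_rotate.
rewrite /leb3 -/(G \o rotate).
rewrite (fubini_tonelli2 (m1 := leb2) (m2 := mu) (G \o rotate)) //.
rewrite (fubini_tonelli1 (m1 := leb2) (m2 := mu) G) //.
rewrite (fubini_tonelli1 (m1 := mu) (m2 := mu) (fubini_F mu G)) //; first last.
- by move=> p; exact: integral_ge0.
- exact: measurable_fun_fubini_tonelli_F.
apply: eq_integral => z _ /=; rewrite /fubini_G /fubini_F.
rewrite (fubini_tonelli1 (m1 := mu) (m2 := mu)
  (fun q : mR * mR => (G \o rotate) (q, z))) //.
  by apply: measurableT_comp => //; exact: measurable_pair2.
  by move=> q; exact: G0.
by move=> p; exact: G0.
Qed.

Lemma eq_integral_fibre G G' : measurable_fun setT G -> (forall p, 0 <= G p) ->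
  measurable_fun setT G' -> (forall p, 0 <= G' p) ->
  (forall q, \int[mu]_z G (q, z) = \int[mu]_z G' (q, z)) ->
  \int[leb3]_p G p = \int[leb3]_p G' p.
Proof.
move=> mG G0 mG' G'0 e.
rewrite /leb3 (fubini_tonelli1 (m1 := leb2) (m2 := mu) G) //.
rewrite (fubini_tonelli1 (m1 := leb2) (m2 := mu) G') //.
by apply: eq_integral => q _; exact: e.
Qed.

End TripleIntegral.

Section CellIntegral.
Context {R : realType}.
Local Notation pi := (@pi R).
Local Notation mR := (measurableTypeR R).
Local Notation X3 := (mR * mR * mR)%type.
Local Open Scope ereal_scope.
Implicit Types (F G : X3 -> \bar R) (f : mR * mR -> mR) (N : set X3).

Definition periodic3 (A : Type) (F : X3 -> A) := forall (p : X3) (m1 m2 m3 : int),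
  F (p.1.1 + m1%:~R * (2 * pi), p.1.2 + m2%:~R * (2 * pi),
     p.2 + m3%:~R * (2 * pi))%R = F p.

Definition shear f (p : X3) : X3 := (p.1, p.2 + f p.1)%R.

Lemma measurable_shear f : measurable_fun setT f -> measurable_fun setT (shear f).
Proof.
move=> mf; apply: measurable_fun_pair => //.
by apply: measurable_funD => //; exact: measurableT_comp mf measurable_fst.
Qed.

Lemma measurable_cell : measurable (@cell R).
Proof. by apply: measurableX => //; exact: measurableX. Qed.

Let cell_cond F : measurable_fun setT F -> measurable_fun setT (F \_ cell).
Proof.
move=> mF; apply/(measurable_restrictT _ measurable_cell).
exact: measurable_funTS.
Qed.

Let cond_ge0 F (D : set X3) p : (forall p, 0 <= F p) -> 0 <= (F \_ D) p.
Proof. by move=> F0; rewrite patchE; case: ifP. Qed.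

Lemma cell_integral_rotate F : measurable_fun setT F -> (forall p, 0 <= F p) ->
  \int[leb3]_(p in cell) F (rotate p) = \int[leb3]_(p in cell) F p.
Proof.
move=> mF F0; rewrite integral_mkcond [RHS]integral_mkcond.
rewrite -(integral_rotate (G := F \_ cell)) //; first last.
- by move=> p; apply: cond_ge0.
- exact: cell_cond.
apply: eq_integral => p _; rewrite !patchE.
congr (if _ then _ else _); apply/idP/idP; rewrite !inE => -[[? ?] ?];
  by split => //; split.
Qed.

(** On every vertical fibre the shear is a translation of a periodic function. *)
Lemma cell_integral_shear F f : measurable_fun setT F -> (forall p, 0 <= F p) ->
  periodic3 F -> measurable_fun setT f ->
  \int[leb3]_(p in cell) F (shear f p) = \int[leb3]_(p in cell) F p.
Proof.
move=> mF F0 pF mf; rewrite integral_mkcond [RHS]integral_mkcond.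
have mFs : measurable_fun setT (F \o shear f).
  exact: measurableT_comp mF (measurable_shear mf).
apply: eq_integral_fibre.
- exact: (cell_cond mFs).
- by move=> p; apply: cond_ge0 => p'; exact: F0.
- exact: cell_cond.
- by move=> p; apply: cond_ge0.
move=> q; pose D : set mR := `[0%R, (2 * pi)%R[%classic.
have [qD|qD] := pselect ((D `*` D) q); last first.
  have E G z : (G \_ cell) (q, z) = 0.
    by rewrite patchE memNset // => -[/= ? _].
  by apply: eq_integral => z _; rewrite !E.
have E G z : (G \_ cell) (q, z) = ((fun z => G (q, z)) \_ D) z.
  rewrite !patchE; congr (if _ then _ else _).
  by apply/idP/idP; rewrite !inE; [case | move=> ?; split].
under eq_integral do rewrite E; under [RHS]eq_integral do rewrite E.
rewrite -!integral_mkcond.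
apply: (periodic_integral_translation (u := fun z => F (q, z)) (f q)) => //.
  exact: (measurable_fun_pair2 _ mF).
move=> s m; have := pF (q, s) 0%R 0%R m; rewrite /= !mul0r !addr0.
by rewrite -surjective_pairing.
Qed.

Lemma measure_preimage_shear N f : measurable N -> measurable_fun setT f ->
  leb3 (shear f @^-1` N) = leb3 N.
Proof.
move=> mN mf.
have mI A : measurable A -> measurable_fun setT (fun p : X3 => (\1_A p)%:E : \bar R).
  by move=> mA; apply/measurable_EFinP; exact: measurable_indic.
have mS : measurable (shear f @^-1` N).
  by rewrite -[X in measurable X]setTI; exact: measurable_shear.
rewrite -[N in RHS]setIT -[_ @^-1` _]setIT -!integral_indic //.
apply: eq_integral_fibre => //; [exact: mI|exact: mI|move=> q].
rewrite -[RHS](@ge0_integral_translation _ _ (f q)) //.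
exact: (measurable_fun_pair2 _ (mI _ mN)).
Qed.

Lemma measure_preimage_rotate N : measurable N -> leb3 (rotate @^-1` N) = leb3 N.
Proof.
move=> mN.
have mI A : measurable A -> measurable_fun setT (fun p : X3 => (\1_A p)%:E : \bar R).
  by move=> mA; apply/measurable_EFinP; exact: measurable_indic.
have mS : measurable (rotate @^-1` N).
  by rewrite -[X in measurable X]setTI; exact: measurable_rotate.
rewrite -[N in RHS]setIT -[_ @^-1` _]setIT -!integral_indic //.
exact: (integral_rotate (G := fun p => (\1_N p)%:E)) (mI _ mN) _.
Qed.

End CellIntegral.

Section CellRintegral.
Context {R : realType}.
Local Notation pi := (@pi R).
Local Notation mR := (measurableTypeR R).
Local Notation mu := (@lebesgue_measure R).
Local Notation X3 := (mR * mR * mR)%type.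
Implicit Types (F G : X3 -> mR) (V : X3 -> X3).

Definition bounded_measurable F :=
  measurable_fun setT F /\ exists C : R, forall p, `|F p| <= C.

Definition cell_Rintegral F : R := \int[leb3]_(p in cell) F p.

Lemma bounded_measurable_cst (c : R) : bounded_measurable (fun=> c).
Proof. by split; [exact: measurable_cst | exists `|c|]. Qed.

Lemma bounded_measurableN F : bounded_measurable F ->
  bounded_measurable (fun p => - F p).
Proof.
move=> [mF [C FC]]; split; first exact: measurable_funN.
by exists C => p; rewrite normrN.
Qed.

Lemma bounded_measurableD F G : bounded_measurable F -> bounded_measurable G ->
  bounded_measurable (fun p => F p + G p).
Proof.
move=> [mF [C FC]] [mG [D GD]]; split; first exact: measurable_funD.
by exists (C + D) => p; apply: le_trans (ler_normD _ _) (lerD (FC p) (GD p)).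
Qed.

Lemma bounded_measurableB F G : bounded_measurable F -> bounded_measurable G ->
  bounded_measurable (fun p => F p - G p).
Proof.
by move=> bF bG; apply: bounded_measurableD => //; exact: bounded_measurableN.
Qed.

Lemma bounded_measurableM F G : bounded_measurable F -> bounded_measurable G ->
  bounded_measurable (fun p => F p * G p).
Proof.
move=> [mF [C FC]] [mG [D GD]]; split; first exact: measurable_funM.
by exists (C * D) => p; rewrite normrM; apply: ler_pM.
Qed.

Lemma bounded_measurable_comp F V : measurable_fun setT V ->
  bounded_measurable F -> bounded_measurable (F \o V).
Proof.
move=> mV [mF [C FC]]; split; first exact: measurableT_comp mF mV.
by exists C => p; exact: FC.
Qed.

Lemma leb3_cell : leb3 (@cell R) = ((2 * pi) ^+ 3)%:E.
Proof.
have p0 : 0 < 2 * pi by rewrite mulr_gt0 // pi_gt0.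
have e : (mu (`[0%R, (2 * pi)%R[ : set mR) = (2 * pi)%:E)%E.
  by rewrite lebesgue_measure_itv /= lte_fin p0 sube0.
pose D : set mR := `[0%R, (2 * pi)%R[%classic.
transitivity (leb2 (D `*` D) * mu D)%E.
  exact: (product_measure1E leb2 mu (measurableX _ _)).
rewrite [X in (X * _)%E](_ : _ = (mu D * mu D)%E); first last.
  by apply: (product_measure1E mu mu); exact: measurable_itv.
by rewrite e -!EFinM; congr (_%:E); ring.
Qed.

Lemma bounded_measurable_integrable F : bounded_measurable F ->
  leb3.-integrable cell (EFin \o F).
Proof.
move=> [mF [C FC]]; apply: measurable_bounded_integrable.
- exact: measurable_cell.
- by rewrite leb3_cell ltry.
- exact: measurable_funTS.
exists C; split; first exact: num_real.
by move=> M CM p _ /=; apply: le_trans (FC p) (ltW CM).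
Qed.

Lemma cell_RintegralE F : bounded_measurable F ->
  (\int[leb3]_(p in cell) (F p)%:E)%E = (cell_Rintegral F)%:E.
Proof.
move=> bF; rewrite /cell_Rintegral /Rintegral fineK //.
apply: integrable_fin_num; first exact: measurable_cell.
exact: bounded_measurable_integrable.
Qed.

Lemma cell_RintegralD F G : bounded_measurable F -> bounded_measurable G ->
  cell_Rintegral (fun p => F p + G p) = cell_Rintegral F + cell_Rintegral G.
Proof.
move=> bF bG; apply: RintegralD; first exact: measurable_cell.
  exact: bounded_measurable_integrable.
exact: bounded_measurable_integrable.
Qed.

Lemma cell_RintegralB F G : bounded_measurable F -> bounded_measurable G ->
  cell_Rintegral (fun p => F p - G p) = cell_Rintegral F - cell_Rintegral G.
Proof.
move=> bF bG; apply: RintegralB; first exact: measurable_cell.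
  exact: bounded_measurable_integrable.
exact: bounded_measurable_integrable.
Qed.

Lemma cell_RintegralZ (c : R) F : bounded_measurable F ->
  cell_Rintegral (fun p => c * F p) = c * cell_Rintegral F.
Proof.
move=> bF; apply: RintegralZl; first exact: measurable_cell.
exact: bounded_measurable_integrable.
Qed.

Lemma le_cell_Rintegral F G : bounded_measurable F -> bounded_measurable G ->
  (forall p, F p <= G p) -> cell_Rintegral F <= cell_Rintegral G.
Proof.
move=> bF bG FG; apply: le_Rintegral => //.
- exact: measurable_cell.
- exact: bounded_measurable_integrable.
- exact: bounded_measurable_integrable.
Qed.

Lemma cell_Rintegral_cst (c : R) : cell_Rintegral (fun=> c) = c * (2 * pi) ^+ 3.
Proof.
by rewrite /cell_Rintegral Rintegral_cst ?leb3_cell //; exact: measurable_cell.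
Qed.

(** Changes of variables are known for nonnegative integrands; a bounded one
becomes nonnegative after adding a constant. *)
Lemma cell_Rintegral_invariant F V : measurable_fun setT V ->
  (forall G : X3 -> \bar R, measurable_fun setT G -> (forall p, 0 <= G p)%E ->
    periodic3 G ->
    \int[leb3]_(p in cell) G (V p) = \int[leb3]_(p in cell) G p)%E ->
  bounded_measurable F -> periodic3 F ->
  cell_Rintegral (fun p => F (V p)) = cell_Rintegral F.
Proof.
move=> mV iV bF pF; have [mF [C FC]] := bF.
have bC := bounded_measurable_cst C.
have H : cell_Rintegral (fun p => F (V p) + C) = cell_Rintegral (fun p => F p + C).
  congr fine; apply: (iV (fun p => (F p + C)%:E)).
  - by apply/measurable_EFinP; exact: measurable_funD.
  - by move=> p; rewrite lee_fin; have := FC p; rewrite ler_norml; lra.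
  - by move=> p m1 m2 m3; rewrite pF.
move: H; rewrite !cell_RintegralD //; first by move/addIr.
exact: (bounded_measurable_comp mV bF).
Qed.

Lemma cell_Rintegral_cvg (F_ : nat -> X3 -> mR) F (C : R) :
  (forall n, measurable_fun setT (F_ n)) -> measurable_fun setT F ->
  (forall n p, `|F_ n p| <= C) ->
  {ae leb3, forall p, F_ ^~ p @ \oo --> (F p : R)} ->
  (fun n => cell_Rintegral (F_ n)) @ \oo --> cell_Rintegral F.
Proof.
move=> mF_ mF FC cF.
have bC := bounded_measurable_cst C.
have i1 n : measurable_fun cell (fun p => (F_ n p)%:E : \bar R).
  by apply/measurable_EFinP; apply: measurable_funTS; exact: mF_.
have i2 : measurable_fun cell (fun p => (F p)%:E : \bar R).
  by apply/measurable_EFinP; exact: measurable_funTS.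
have i3 : {ae leb3, forall p, cell p -> (fun n => (F_ n p)%:E) @ \oo --> (F p)%:E}.
  by apply: filterS cF => p cp _; apply: cvg_EFin => //; exact: nearW.
have i5 : {ae leb3, forall p n, cell p -> (`|(F_ n p)%:E| <= C%:E)%E}.
  by apply: aeW => p n _; rewrite lee_fin; exact: FC.
have [ig _ cv] := dominated_convergence measurable_cell i1 i2 i3
  (bounded_measurable_integrable bC) i5.
apply: fine_cvg; rewrite fineK //.
by apply: integrable_fin_num => //; exact: measurable_cell.
Qed.

End CellRintegral.

(** * Almost everywhere directional derivatives and null Lagrangians *)

Section WeakDerivatives.
Context {R : realType}.
Local Notation mR := (measurableTypeR R).
Local Notation X3 := (mR * mR * mR)%type.
Implicit Types (u v f : X3 -> mR) (d e : R * R * R) (t : R).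

Definition move d t (p : X3) : X3 :=
  (p.1.1 + t * d.1.1, p.1.2 + t * d.1.2, p.2 + t * d.2).

Lemma measurable_move d t : measurable_fun setT (move d t).
Proof.
apply: measurable_fun_pair; first apply: measurable_fun_pair.
- by apply: measurable_funD => //; exact: measurable_px.
- by apply: measurable_funD => //; exact: measurable_py.
- by apply: measurable_funD => //; exact: measurable_pz.
Qed.

Lemma moveC d e t t' p : move d t (move e t' p) = move e t' (move d t p).
Proof. by rewrite /move /=; congr (_, _, _); ring. Qed.

Lemma move0 d p : move d 0 p = p.
Proof. by case: p => [[x y] z]; rewrite /move /= !mul0r !addr0. Qed.

Lemma moveD d t t' p : move d t (move d t' p) = move d (t' + t) p.
Proof. by rewrite /move /=; congr (_, _, _); ring. Qed.

Lemma moveNK d t p : move d (- t) (move d t p) = p.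
Proof. by rewrite moveD addrN move0. Qed.

Lemma periodic3_move A (F : X3 -> A) d t : periodic3 F -> periodic3 (F \o move d t).
Proof.
move=> pF p m1 m2 m3; rewrite -[RHS](pF (move d t p) m1 m2 m3) /=.
by congr (F _); rewrite /move /=; congr (_, _, _); ring.
Qed.

(** Three shears of the last coordinate, by t c, t a and t b, conjugated by
rotations: V1, V2 and V3 are the maps that remain after each of them. *)
Lemma cell_integral_move (G : X3 -> \bar R) d t :
  measurable_fun setT G -> (forall p, 0 <= G p)%E -> periodic3 G ->
  (\int[leb3]_(p in cell) G (move d t p) = \int[leb3]_(p in cell) G p)%E.
Proof.
case: d => [[a b] c] mG G0 pG.
have mc (k : R) : measurable_fun setT (fun _ : mR * mR => k : mR) by [].
have mm (V : X3 -> X3) : measurable_fun setT V -> measurable_fun setT (G \o V).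
  by move=> mV; exact: measurableT_comp mG mV.
have mk (V : X3 -> mR) k : measurable_fun setT V ->
    measurable_fun setT (fun p => V p + k : mR).
  by move=> mV; exact: measurable_funD.
have [[mx my] mz] := (@measurable_px R, @measurable_py R, @measurable_pz R).
pose V1 (p : X3) : X3 := (p.1.1 + t * a, p.1.2 + t * b, p.2).
pose V2 (p : X3) : X3 := (p.2, p.1.1 + t * b, p.1.2).
pose V3 (p : X3) : X3 := (p.1.2, p.2, p.1.1).
have mp (f1 f2 f3 : X3 -> mR) : measurable_fun setT f1 -> measurable_fun setT f2 ->
    measurable_fun setT f3 -> measurable_fun setT (fun p => (f1 p, f2 p, f3 p) : X3).
  move=> m1 m2 m3; apply: measurable_fun_pair => //.
  exact: measurable_fun_pair.
have mV1 : measurable_fun setT V1 by apply: mp => //; exact: mk.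
have mV2 : measurable_fun setT V2 by apply: mp => //; exact: mk.
have mV3 : measurable_fun setT V3 by apply: mp.
have E1 := cell_integral_shear (mm _ mV1) (fun p => G0 _) _ (mc (t * c)).
have E2 := cell_integral_shear (mm _ mV2) (fun p => G0 _) _ (mc (t * a)).
have E3 := cell_integral_shear (mm _ mV3) (fun p => G0 _) _ (mc (t * b)).
rewrite [LHS]E1; last first.
  move=> p m1 m2 m3; rewrite -[RHS](pG _ m1 m2 m3) /V1 /=.
  by congr (G _); congr (_, _, _); ring.
rewrite -(cell_integral_rotate (mm _ mV1) (fun p => G0 _)).
rewrite [LHS]E2; last first.
  move=> p m1 m2 m3; rewrite -[RHS](pG _ m3 m1 m2) /V2 /=.
  by congr (G _); congr (_, _, _); ring.
rewrite -(cell_integral_rotate (mm _ mV2) (fun p => G0 _)).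
rewrite [LHS]E3; last first.
  by move=> p m1 m2 m3; rewrite -[RHS](pG _ m2 m3 m1).
transitivity (\int[leb3]_(p in cell) (G \o rotate) p)%E.
  rewrite -(cell_integral_rotate (mm _ (@measurable_rotate R)) (fun p => G0 _)).
  by apply: eq_integral => -[[x y] z] _.
exact: cell_integral_rotate.
Qed.

Lemma cell_Rintegral_move u d t : bounded_measurable u -> periodic3 u ->
  cell_Rintegral (fun p => u (move d t p)) = cell_Rintegral u.
Proof.
move=> bu pu; apply: cell_Rintegral_invariant => //; first exact: measurable_move.
by move=> G mG G0 pG; exact: cell_integral_move.
Qed.

Definition dquot u d t (p : X3) : R := (u (move d t p) - u p) / t.

Lemma dquot_mean0 u d t : bounded_measurable u -> periodic3 u ->
  cell_Rintegral (dquot u d t) = 0.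
Proof.
move=> bu pu; have bm := bounded_measurable_comp (measurable_move d t) bu.
rewrite (_ : dquot u d t = fun p => t^-1 * (u (move d t p) - u p)).
  rewrite cell_RintegralZ; last exact: bounded_measurableB.
  by rewrite cell_RintegralB // cell_Rintegral_move // subrr mulr0.
by apply/funext => p; rewrite /dquot mulrC.
Qed.

(** By invariance under translations, both sides are the integral of u times a
second difference of f, which is symmetric in d and e.  The opposite steps t
and - t are what makes the two second differences coincide. *)
Lemma dquot_swap u f d e t : bounded_measurable u -> periodic3 u ->
  bounded_measurable f -> periodic3 f ->
  cell_Rintegral (fun p => dquot u d t p * dquot f e (- t) p) =
  cell_Rintegral (fun p => dquot u e t p * dquot f d (- t) p).
Proof.
move=> bu pu bf pf.
have bmv g d' t' : bounded_measurable g -> bounded_measurable (g \o move d' t').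
  exact: bounded_measurable_comp (measurable_move d' t').
have key d' e' : cell_Rintegral (fun p => dquot u d' t p * dquot f e' (- t) p) =
    - (t^-1 ^+ 2) * cell_Rintegral (fun p => u p *
      (f (move e' (- t) (move d' (- t) p)) - f (move d' (- t) p)
       - (f (move e' (- t) p) - f p))).
  have b1 := bmv u d' t bu; have b2 := bmv f e' (- t) bf.
  have b3 := bmv _ d' (- t) b2; have b4 := bmv f d' (- t) bf.
  transitivity (- (t^-1 ^+ 2) * cell_Rintegral (fun p =>
      u (move d' t p) * (f (move e' (- t) p) - f p)
      - u p * (f (move e' (- t) p) - f p))).
    rewrite -cell_RintegralZ; last first.
      apply: bounded_measurableB; apply: bounded_measurableM => //;
      exact: bounded_measurableB.
    congr cell_Rintegral; apply/funext => p; rewrite /dquot invrN; ring.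
  congr (_ * _); rewrite cell_RintegralB; first last.
  - by apply: bounded_measurableM => //; exact: bounded_measurableB.
  - by apply: bounded_measurableM => //; exact: bounded_measurableB.
  rewrite (_ : cell_Rintegral (fun p => u (move d' t p) * _) = cell_Rintegral (fun p =>
      u p * (f (move e' (- t) (move d' (- t) p)) - f (move d' (- t) p)))).
    rewrite -cell_RintegralB; first last.
    - by apply: bounded_measurableM => //; exact: bounded_measurableB.
    - by apply: bounded_measurableM => //; exact: bounded_measurableB.
    by congr cell_Rintegral; apply/funext => p; rewrite -mulrBr.
  rewrite -[RHS](@cell_Rintegral_move _ d' t); first last.
  - move=> p m1 m2 m3; rewrite pu; congr (_ * (_ - _)).
      exact: (periodic3_move d' (- t) (periodic3_move e' (- t) pf)).
    exact: (periodic3_move d' (- t) pf).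
  - by apply: bounded_measurableM => //; exact: bounded_measurableB.
  by congr cell_Rintegral; apply/funext => p; rewrite moveNK.
rewrite !key; congr (_ * cell_Rintegral _); apply/funext => p.
by rewrite (moveC d e); ring.
Qed.

(** The regularity under which u' is also the distributional derivative of u
along d: the difference quotients are bounded and converge almost everywhere.
It holds for the potentials, for [h] of a coordinate and for test functions. *)
Record slope_along d u u' : Prop := {
  slope_bounded : bounded_measurable u;
  slope_periodic : periodic3 u;
  slope_lipschitz : exists L : R, forall p t, `|u (move d t p) - u p| <= L * `|t|;
  slope_deriv_bounded : bounded_measurable u';
  slope_deriv : {ae leb3, forall p,
    is_derive (0 : R) (1 : R) (fun t => u (move d t p) : R) (u' p)}
}.

Lemma is_derive_dquot u d p (l : R) (s : nat -> R) :
  is_derive (0 : R) (1 : R) (fun t => u (move d t p) : R) l ->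
  (forall n, s n != 0) -> s @ \oo --> 0 ->
  (fun n => dquot u d (s n) p) @ \oo --> l.
Proof.
move=> [du <-] s0 cs; rewrite /dquot.
have /cvgr_dnbhsP /(_ s (conj s0 cs)) : (fun t : R => t^-1 *:
    (((fun t => u (move d t p) : R) \o shift 0) (t *: 1) - u (move d 0 p)))
    @ 0^' --> 'D_1 (fun t => u (move d t p) : R) 0 by exact: du.
move=> c; apply: cvg_trans c; apply: near_eq_cvg; apply: nearW => n /=.
by rewrite move0 addr0 [s n *: 1]mulr1 mulrC.
Qed.

Lemma dquot_le u d L t p : (forall p t, `|u (move d t p) - u p| <= L * `|t|) ->
  t != 0 -> `|dquot u d t p| <= L.
Proof.
by move=> uL t0; rewrite normrM normfV ler_pdivrMr ?normr_gt0.
Qed.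

Lemma measurable_dquot u d t : measurable_fun setT u ->
  measurable_fun setT (dquot u d t : X3 -> mR).
Proof.
move=> mu; apply: measurable_funM => //; apply: measurable_funB => //.
exact: measurableT_comp mu (measurable_move d t).
Qed.

Let harm0 n : (harmonic n : R) != 0.
Proof. by rewrite gt_eqF // harmonic_gt0. Qed.

Let harmN0 n : - (harmonic n : R) != 0.
Proof. by rewrite oppr_eq0. Qed.

Let cvg_harmN : (fun n => - (harmonic n : R)) @ \oo --> (0 : R).
Proof. by rewrite -oppr0; apply: cvgN; exact: cvg_harmonic. Qed.

Lemma slope_mean0 d u u' : slope_along d u u' -> cell_Rintegral u' = 0.
Proof.
move=> [bu pu [L uL] [mu' _] du].
have : (fun n => cell_Rintegral (dquot u d (harmonic n))) @ \oo --> cell_Rintegral u'.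
  apply: (@cell_Rintegral_cvg _ _ _ L) => //.
  - by move=> n; apply: measurable_dquot; case: bu.
  - by move=> n p; apply: dquot_le.
  by apply: filterS du => p dp; apply: is_derive_dquot => //; exact: cvg_harmonic.
rewrite (_ : (fun n => _) = cst 0).
  move=> c; rewrite -(cvg_lim (@Rhausdorff R) c).
  by rewrite lim_cst.
by apply/funext => n; rewrite dquot_mean0.
Qed.

(** The integral of the null Lagrangian d_d u d_e f - d_e u d_d f vanishes:
pass to the limit in [dquot_swap].  This says both that a curl is divergence
free and that it can be integrated by parts against a Lipschitz function. *)
Lemma slope_swap d e u u1 u2 f f1 f2 :
  slope_along d u u1 -> slope_along e u u2 ->
  slope_along d f f1 -> slope_along e f f2 ->
  cell_Rintegral (fun p => u1 p * f2 p) = cell_Rintegral (fun p => u2 p * f1 p).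
Proof.
move=> [bu pu [L1 uL1] [mu1 _] du1] [_ _ [L2 uL2] [mu2 _] du2].
move=> [bf pf [K1 fK1] [mf1 _] df1] [_ _ [K2 fK2] [mf2 _] df2].
have H d' e' u' f' L K : (forall p t, `|u (move d' t p) - u p| <= L * `|t|) ->
    (forall p t, `|f (move e' t p) - f p| <= K * `|t|) ->
    measurable_fun setT u' -> measurable_fun setT f' ->
    {ae leb3, forall p,
      is_derive (0 : R) (1 : R) (fun t => u (move d' t p) : R) (u' p)} ->
    {ae leb3, forall p,
      is_derive (0 : R) (1 : R) (fun t => f (move e' t p) : R) (f' p)} ->
    (fun n => cell_Rintegral (fun p =>
      dquot u d' (harmonic n) p * dquot f e' (- harmonic n) p)) @ \oo -->
    cell_Rintegral (fun p => u' p * f' p).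
  move=> uL fK mu' mf' du df; apply: (@cell_Rintegral_cvg _ _ _ (L * K)).
  - by move=> n; apply: measurable_funM; apply: measurable_dquot; [case: bu|case: bf].
  - exact: measurable_funM.
  - by move=> n p; rewrite normrM; apply: ler_pM => //; exact: dquot_le.
  apply: filterS2 du df => p dup dfp; apply: cvgM.
    by apply: is_derive_dquot => //; exact: cvg_harmonic.
  by apply: is_derive_dquot.
have c1 := H _ _ _ _ _ _ uL1 fK2 mu1 mf2 du1 df2.
have c2 := H _ _ _ _ _ _ uL2 fK1 mu2 mf1 du2 df1.
have E : (fun n => cell_Rintegral (fun p =>
      dquot u d (harmonic n) p * dquot f e (- harmonic n) p)) =
    (fun n => cell_Rintegral (fun p =>
      dquot u e (harmonic n) p * dquot f d (- harmonic n) p)).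
  by apply/funext => n; rewrite dquot_swap.
rewrite E in c1; rewrite -(cvg_lim (@Rhausdorff R) c1).
exact: (cvg_lim (@Rhausdorff R) c2).
Qed.

End WeakDerivatives.

(** * Coordinates of the backward orbit *)

Section BackwardOrbit.
Context {R : realType}.
Variable al : R.
Local Notation pi := (@pi R).
Local Notation mR := (measurableTypeR R).
Local Notation mu := (@lebesgue_measure R).
Local Notation X3 := (mR * mR * mR)%type.
Implicit Types (p : X3) (d : R * R * R) (t : R).

(** The last coordinate of the n-th preimage of p under [step]; see
[coord_unstep]. *)
Fixpoint coord (n : nat) p : R :=
  match n with
  | 0 => p.2
  | n1.+1 => match n1 with
    | 0 => p.1.2
    | n2.+1 => match n2 with
      | 0 => p.1.1
      | n3.+1 => coord n3 p - al * h (coord n1 p)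
      end end end.

Lemma coordS n p : coord n.+3 p = coord n p - al * h (coord n.+2 p).
Proof. by []. Qed.

Definition unstep p : X3 := (p.2 - al * h p.1.1, p.1.1, p.1.2).

(** The three shears that compose T are conjugate to each other by rotations of
the coordinates, and T is the third iterate of this map. *)
Definition step p : X3 := (p.1.2, p.2, p.1.1 + al * h p.1.2).

Lemma stepK p : unstep (step p) = p.
Proof. by case: p => [[x y] z]; rewrite /unstep /step /= addrK. Qed.

Lemma unstepK p : step (unstep p) = p.
Proof. by case: p => [[x y] z]; rewrite /unstep /step /= subrK. Qed.

Lemma coord_unstep n p : coord n (unstep p) = coord n.+1 p.
Proof.
by elim/nat_ind3: n => [//|//|//|n IH0 IH1 IH2]; rewrite !coordS IH0 IH2.
Qed.

Definition sgn p (n : nat) : R := slope_sign (coord n p).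

Lemma normr_sgn p n : `|sgn p n| = 1.
Proof. exact: normr_slope_sign. Qed.

Lemma sgn_pm p n : sgn p n = 1 \/ sgn p n = - 1.
Proof. exact: slope_sign_pm. Qed.

Lemma measurable_coord n : measurable_fun setT (coord n : X3 -> mR).
Proof.
elim/nat_ind3: n => [|||n IH0 IH1 IH2].
- exact: measurable_pz.
- exact: measurable_py.
- exact: measurable_px.
apply: measurable_funB => //; apply: measurable_funM => //.
exact: measurableT_comp (@measurable_h R) IH2.
Qed.

Lemma measurable_sgn n : measurable_fun setT (fun p => sgn p n : mR).
Proof. exact: measurableT_comp (@measurable_slope_sign R) (measurable_coord n). Qed.

Lemma measurable_tang d n : measurable_fun setT (fun p => tang al (sgn p) d n : mR).
Proof.
elim/nat_ind3: n => [//|//|//|n IH0 IH1 IH2].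
apply: measurable_funB => //; apply: measurable_funM => //.
by apply: measurable_funM => //; exact: measurable_sgn.
Qed.

Lemma measurable_step : measurable_fun setT step.
Proof.
apply: measurable_fun_pair.
  by apply: measurable_fun_pair; [exact: measurable_py|exact: measurable_pz].
apply: measurable_funD; first exact: measurable_px.
apply: measurable_funM => //.
exact: measurableT_comp (@measurable_h R) (@measurable_py R).
Qed.

Lemma measurable_unstep : measurable_fun setT unstep.
Proof.
apply: measurable_fun_pair; last exact: measurable_py.
apply: measurable_fun_pair; last exact: measurable_px.
apply: measurable_funB; first exact: measurable_pz.
apply: measurable_funM => //.
exact: measurableT_comp (@measurable_h R) (@measurable_px R).
Qed.

Lemma coord_translate p (m1 m2 m3 : int) n : exists m : int,
  coord n (p.1.1 + m1%:~R * (2 * pi), p.1.2 + m2%:~R * (2 * pi),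
    p.2 + m3%:~R * (2 * pi)) = coord n p + m%:~R * (2 * pi).
Proof.
elim/nat_ind3: n => [|||n [k0 IH0] _ [k2 IH2]].
- by exists m3.
- by exists m2.
- by exists m1.
by exists k0; rewrite !coordS IH0 IH2 hD; ring.
Qed.

Lemma periodic3_coord (A : Type) (c : R -> A) n :
  (forall s (m : int), c (s + m%:~R * (2 * pi)) = c s) ->
  periodic3 (fun p => c (coord n p)).
Proof.
by move=> cp p m1 m2 m3; have [m ->] := coord_translate p m1 m2 m3 n; rewrite cp.
Qed.

Lemma periodic3_sgn n : periodic3 (fun p => sgn p n).
Proof. by apply: periodic3_coord; exact: slope_signD. Qed.

Lemma coord_lipschitz d n : exists L : R,
  forall p t, `|coord n (move d t p) - coord n p| <= L * `|t|.
Proof.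
have base (a b c : R) : (forall t, b = a + t * c -> `|b - a| <= `|c| * `|t|).
  by move=> t ->; rewrite addrAC subrr add0r normrM mulrC.
elim/nat_ind3: n => [|||n [L0 IH0] _ [L2 IH2]].
- by exists `|d.2| => p t; exact: base.
- by exists `|d.1.2| => p t; exact: base.
- by exists `|d.1.1| => p t; exact: base.
exists (L0 + `|al| * L2) => p t; rewrite !coordS.
rewrite (_ : _ - _ = (coord n (move d t p) - coord n p) -
  al * (h (coord n.+2 (move d t p)) - h (coord n.+2 p))); last by ring.
rewrite mulrDl; apply: le_trans (ler_normB _ _) _; apply: lerD => //.
rewrite normrM -mulrA ler_wpM2l //.
exact: le_trans (h_lipschitz _ _) (IH2 p t).
Qed.

Lemma cell_integral_unstep (G : X3 -> \bar R) :
  measurable_fun setT G -> (forall p, 0 <= G p)%E -> periodic3 G ->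
  (\int[leb3]_(p in cell) G (unstep p) = \int[leb3]_(p in cell) G p)%E.
Proof.
move=> mG G0 pG.
have mGr : measurable_fun setT (G \o rotate).
  exact: measurableT_comp mG (@measurable_rotate R).
rewrite -[RHS]cell_integral_rotate //.
rewrite -[RHS](cell_integral_shear (F := G \o rotate)
  (f := fun q : mR * mR => - (al * h q.1))) //.
- by move=> p; exact: G0.
- by move=> p m1 m2 m3; exact: (pG (rotate p) m3 m1 m2).
apply: measurable_funN; apply: measurable_funM => //.
exact: measurableT_comp (@measurable_h R) measurable_fst.
Qed.

(** [unstep] preserves the integral over the torus and shifts the coordinates. *)
Lemma cell_Rintegral_coord (c : mR -> mR) n : measurable_fun setT c ->
  (exists C : R, forall s, `|c s| <= C) ->
  (forall s (m : int), c (s + m%:~R * (2 * pi)) = c s) ->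
  cell_Rintegral (fun p => c (coord n p)) = cell_Rintegral (fun p => c p.2).
Proof.
move=> mc [C cC] pc; elim: n => [//|n <-].
under eq_fun do rewrite -coord_unstep.
apply: (@cell_Rintegral_invariant _ (fun p => c (coord n p)) unstep).
- exact: measurable_unstep.
- exact: cell_integral_unstep.
- split; first exact: measurableT_comp mc (measurable_coord n).
  by exists C.
- exact: periodic3_coord.
Qed.

(** [unstep] is a shear of the last coordinate after a rotation. *)
Lemma leb3_preimage_unstep (N : set X3) : measurable N ->
  leb3 (unstep @^-1` N) = leb3 N.
Proof.
move=> mN; rewrite -[RHS]measure_preimage_rotate //.
have mr : measurable (rotate @^-1` N).
  by rewrite -[X in measurable X]setTI; exact: measurable_rotate.
rewrite -(measure_preimage_shear (f := fun q : mR * mR => - (al * h q.1)) mr) //.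
apply: measurable_funN; apply: measurable_funM => //.
exact: measurableT_comp (@measurable_h R) measurable_fst.
Qed.

Lemma leb3_preimage_step (N : set X3) : measurable N ->
  leb3 (step @^-1` N) = leb3 N.
Proof.
move=> mN; have ms : measurable (step @^-1` N).
  by rewrite -[X in measurable X]setTI; exact: measurable_step.
rewrite -measure_preimage_rotate //.
rewrite -[RHS](measure_preimage_shear (f := fun q : mR * mR => al * h q.1)) //.
  by congr (leb3 _); apply/seteqP; split => -[[x y] z].
apply: measurable_funM => //.
exact: measurableT_comp (@measurable_h R) measurable_fst.
Qed.

Lemma countable_Sigma : countable (@Sigma R).
Proof.
rewrite (_ : Sigma = \bigcup_(k in [set: int]) [set k%:~R * pi]).
  by apply: bigcup_countable => // k _; exact: countable1.
by apply/seteqP; split => s [k]; [exists k | move=> _ ->; exists k].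
Qed.

Lemma measurable_Sigma : measurable (@Sigma R : set mR).
Proof. exact: countable_measurable countable_Sigma. Qed.

Lemma measurable_coord_Sigma n : measurable [set p : X3 | Sigma (coord n p)].
Proof.
rewrite -[X in measurable X]setTI; apply: (measurable_coord n) => //.
exact: measurable_Sigma.
Qed.

Lemma leb3_coord_Sigma n : leb3 [set p : X3 | Sigma (coord n p)] = 0%E.
Proof.
elim: n => [|n IH].
  rewrite (_ : [set p : X3 | _] = setT `*` Sigma); last first.
    by apply/seteqP; split => [p|p []].
  transitivity (leb2 setT * mu Sigma)%E.
    by apply: (product_measure1E leb2 mu) => //; exact: measurable_Sigma.
  rewrite (countable_lebesgue_measure0 countable_Sigma) mule0 //.
rewrite -IH -[RHS]leb3_preimage_unstep; last exact: measurable_coord_Sigma.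
by congr (leb3 _); apply/seteqP; split => p /=; rewrite coord_unstep.
Qed.

Lemma ae_coord : {ae leb3, forall p, forall n, ~ Sigma (coord n p)}.
Proof.
have H n : leb3.-negligible [set p : X3 | Sigma (coord n p)].
  apply/negligibleP; first exact: measurable_coord_Sigma.
  exact: leb3_coord_Sigma.
apply: negligibleS (negligible_bigcup H) => p /= /existsNP [n] /contrapT Sn.
by exists n.
Qed.

Lemma is_derive_comp_coord (c : R -> R) dc n d p (l : R) :
  is_derive (coord n p) 1 c dc ->
  is_derive (0 : R) (1 : R) (fun t => coord n (move d t p)) l ->
  is_derive (0 : R) (1 : R) (fun t => c (coord n (move d t p))) (dc * l).
Proof.
move=> Dc Dn.
have Dc' : is_derive ((fun t => coord n (move d t p)) 0) 1 c dc by rewrite move0.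
exact: (is_derive1_comp Dc' Dn).
Qed.

(** The chain rule along the recursion; h is differentiable at the coordinates
that it meets. *)
Lemma coord_is_derive d p n : (forall j, (j < n)%N -> ~ Sigma (coord j p)) ->
  is_derive (0 : R) (1 : R) (fun t => coord n (move d t p)) (tang al (sgn p) d n).
Proof.
have base (a c : R) : is_derive (0 : R) (1 : R) (fun t => a + t * c) c.
  rewrite (_ : (fun t => _) = fun t => a + c * t); first exact: is_derive_affine.
  by apply/funext => t; rewrite mulrC.
elim/nat_ind3: n => [|||n IH0 IH1 IH2] nS; try exact: base.
have D2 : is_derive (0 : R) (1 : R) (fun t => coord n.+2 (move d t p))
    (tang al (sgn p) d n.+2).
  by apply: IH2 => j jn; apply: nS; exact: ltnW.
have D0 : is_derive (0 : R) (1 : R) (fun t => coord n (move d t p))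
    (tang al (sgn p) d n).
  by apply: IH0 => j jn; apply: nS; rewrite -addn3 ltn_addr.
have Dh := is_derive_comp_coord (h_is_derive (nS n.+2 (ltnSn _))) D2.
by rewrite tangS -mulrA; exact: is_derive_subZ D0 Dh.
Qed.

End BackwardOrbit.

(** * The vector potentials and their curls *)

Section Potential.
Context {R : realType}.
Variable al : R.
Local Notation pi := (@pi R).
Local Notation mR := (measurableTypeR R).
Local Notation mu := (@lebesgue_measure R).
Local Notation X3 := (mR * mR * mR)%type.
Implicit Types (p : X3) (d e : R * R * R) (t : R).
Local Notation coord := (coord al).
Local Notation sgn := (sgn al).
Local Notation tg d n p := (tang al (sgn p) d n).
Local Notation sl d n p := (slope al (sgn p) d n).

(** The square of m = 24 2^n, so that [bump_defect_integral] bounds the integral of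
the defect of the n-th bump by 2^-(n+1). *)
Definition weight (n : nat) : R := (24 * 2 ^+ n) ^+ 2.

Lemma weight_ge0 n : 0 <= weight n.
Proof. by rewrite sqr_ge0. Qed.

Lemma measurable_inv : measurable_fun [set: mR] (fun s : mR => s^-1 : mR).
Proof.
rewrite (_ : (fun s => _) = fun s : mR => s * powR (s ^+ 2) (- 1)).
  apply: measurable_funM => //.
  apply: (measurableT_comp (@measurable_powR R (- 1))).
  exact: measurable_funX.
apply/funext => s; rewrite powR_inv1 ?sqr_ge0 //.
have [->|s0] := eqVneq s 0; first by rewrite invr0 mul0r.
by field.
Qed.

Lemma measurable_slope d n : measurable_fun setT (fun p => sl d n p : mR).
Proof.
apply: measurable_funM; first exact: measurable_tang.
exact: measurableT_comp measurable_inv (measurable_tang al (1, 0, 0) n).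
Qed.

Fixpoint psi n p : R :=
  if n is m.+1 then psi m p * bump (weight m) (coord m p) else 1.

Fixpoint dpsi d n p : R :=
  if n is m.+1 then
    dpsi d m p * bump (weight m) (coord m p)
    + psi m p * (dbump (weight m) (coord m p) * tg d m p)
  else 0.

(** The component along e of the potential A_n = s psi_n eta_n; the factor
s = h'(z) makes the product of its x-component with h'(z) nonnegative. *)
Definition pot e n p : R := sgn p 0 * (psi n p * sl e n p).

(** The derivative of [pot e] along d: the sign and the slope are locally constant. *)
Definition dpot d e n p : R := sgn p 0 * (dpsi d n p * sl e n p).

Definition curl d e n p : R := dpot d e n p - dpot e d n p.

Definition dir (i : nat) : R * R * R :=
  match i with 0 => (1, 0, 0) | 1 => (0, 1, 0) | _ => (0, 0, 1) end.

Lemma psi01 n p : 0 <= psi n p <= 1.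
Proof.
elim: n => [|n /andP[a b]] /=; first by rewrite ler01 lexx.
by rewrite mulr_ge0 ?bump_ge0 ?weight_ge0 // mulr_ile1 ?bump_ge0 ?bump_le1 ?weight_ge0.
Qed.

Lemma measurable_psi n : measurable_fun setT (psi n : X3 -> mR).
Proof.
elim: n => [|n IH]; first exact: measurable_cst.
apply: (@measurable_funM _ _ _ _ (psi n) (fun p => bump (weight n) (coord n p))) => //.
exact: measurableT_comp (measurable_bump (weight_ge0 n)) (measurable_coord al n).
Qed.

Lemma measurable_dpsi d n : measurable_fun setT (dpsi d n : X3 -> mR).
Proof.
elim: n => [|n IH]; first exact: measurable_cst.
apply: (@measurable_funD _ _ _ _
  (fun p => dpsi d n p * bump (weight n) (coord n p))
  (fun p => psi n p * (dbump (weight n) (coord n p) * tg d n p)));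
  apply: measurable_funM => //.
- exact: measurableT_comp (measurable_bump (weight_ge0 n)) (measurable_coord al n).
- exact: measurable_psi.
apply: measurable_funM; last exact: measurable_tang.
exact: measurableT_comp (measurable_dbump (weight_ge0 n)) (measurable_coord al n).
Qed.

Lemma periodic3_tang d n : periodic3 (fun p => tg d n p).
Proof.
move=> p m1 m2 m3; apply: eq_tang => j _.
exact: (periodic3_sgn al j p m1 m2 m3).
Qed.

Lemma periodic3_slope d n : periodic3 (fun p => sl d n p).
Proof.
by move=> p m1 m2 m3; rewrite /slope; congr (_ / _); exact: periodic3_tang.
Qed.

Lemma periodic3_psi n : periodic3 (psi n).
Proof.
elim: n => [//|n IH] p m1 m2 m3 /=; congr (_ * _); first exact: IH.
exact: (periodic3_coord al n (bumpD (weight n))).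
Qed.

Lemma periodic3_dpsi d n : periodic3 (dpsi d n).
Proof.
elim: n => [//|n IH] p m1 m2 m3 /=; congr (_ * _ + _ * (_ * _)).
- exact: IH.
- exact: (periodic3_coord al n (bumpD (weight n))).
- exact: periodic3_psi.
- exact: (periodic3_coord al n (dbumpD (weight n))).
- exact: periodic3_tang.
Qed.

Lemma periodic3_dpot d e n : periodic3 (dpot d e n).
Proof.
move=> p m1 m2 m3; congr (_ * (_ * _)).
- exact: periodic3_sgn.
- exact: periodic3_dpsi.
- exact: periodic3_slope.
Qed.

Section IntegralOfPsi.

Let Rintegral_bump_defect n :
  cell_Rintegral (fun p : X3 => 1 - bump (weight n) p.2) <= (2 * pi) ^+ 2 / 2 ^+ n.+1.
Proof.
have p0 : 0 < 2 * pi by rewrite mulr_gt0 // pi_gt0.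
pose D : set mR := `[0%R, (2 * pi)%R[%classic.
pose c (s : mR) : R := 1 - bump (weight n) s.
have c0 s : 0 <= c s by rewrite subr_ge0 bump_le1 ?weight_ge0.
have mc : measurable_fun setT (c : mR -> mR).
  by apply: measurable_funB => //; exact: measurable_bump (weight_ge0 n).
have bc : bounded_measurable (fun p : X3 => c p.2).
  split; first exact: measurableT_comp mc (@measurable_pz R).
  exists 1 => p; rewrite ger0_norm ?c0 // /c gerBl bump_ge0 ?weight_ge0 //.
have mG : measurable_fun setT ((fun p : X3 => (c p.2)%:E) \_ cell).
  apply/(measurable_restrictT _ (@measurable_cell R)).
  by apply/measurable_EFinP/measurable_funTS; case: bc.
have G0 p : (0 <= ((fun p : X3 => (c p.2)%:E) \_ cell) p)%E.
  by rewrite patchE; case: ifP => // _; rewrite lee_fin c0.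
have mF := measurable_fun_fubini_tonelli_F (m2 := mu) _ mG G0.
rewrite -lee_fin -(cell_RintegralE bc) integral_mkcond.
rewrite /leb3 (fubini_tonelli1 (m1 := leb2) (m2 := mu) _ mG G0).
rewrite /fubini_F.
pose I : R := 12 / (24 * 2 ^+ n).
have m0 : 0 < 24 * 2 ^+ n :> R by rewrite mulr_gt0 // exprn_gt0.
have I0 : 0 <= I by rewrite divr_ge0 // ltW.
have mDD : measurable (D `*` D) by apply: measurableX; exact: measurable_itv.
have E (q : mR * mR) : (\int[mu]_z ((fun p : X3 => (c p.2)%:E) \_ cell) (q, z) <=
    (I * \1_(D `*` D) q)%:E)%E.
  rewrite indicE; case: (boolP (q \in D `*` D)) => qD; last first.
    rewrite mulr0 (eq_integral (fun=> 0%E)) ?integral0 // => z _.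
    by rewrite patchE memNset // => -[/= qD' _]; move/negP: qD; apply; rewrite inE.
  rewrite mulr1 (eq_integral ((fun z => (c z)%:E) \_ D)).
    by rewrite -integral_mkcond; exact: bump_defect_integral.
  move=> z _; rewrite !patchE /=; congr (if _ then _ else _).
  by apply/idP/idP; rewrite !inE; [case | move=> ?; split => //; rewrite inE in qD].
apply: (@le_trans _ _ (\int[leb2]_q (I * \1_(D `*` D) q)%:E)%E).
  apply: ge0_le_integral => //.
  - by move=> q _; apply: integral_ge0 => z _; exact: G0.
  - by apply/measurable_EFinP; exact: measurable_funM.
under eq_integral do rewrite EFinM.
rewrite ge0_integralZl //; last by apply/measurable_EFinP; exact: measurable_indic.
rewrite integral_indic // setIT.
rewrite [X in (_ * X)%E](_ : _ = ((2 * pi) * (2 * pi))%:E); last first.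
  transitivity (mu D * mu D)%E.
    by apply: (product_measure1E mu mu); exact: measurable_itv.
  by rewrite lebesgue_measure_itv /= lte_fin p0 sube0 -EFinM.
rewrite -EFinM lee_fin le_eqVlt; apply/orP; left; apply/eqP.
by rewrite /I [2 ^+ n.+1]exprS; field; rewrite expf_neq0.
Qed.

Lemma bounded_measurable_psi n : bounded_measurable (psi n).
Proof.
split; first exact: measurable_psi.
by exists 1 => p; have /andP[a b] := psi01 n p; rewrite ger0_norm.
Qed.

(** By induction on n, using psi g >= psi - (1 - g) for psi and g in [0, 1]. *)
Lemma cell_Rintegral_psi n :
  (2 * pi) ^+ 3 - (2 * pi) ^+ 2 * (1 - 2^-1 ^+ n) <= cell_Rintegral (psi n).
Proof.
elim: n => [|n IH] /=.
  by rewrite cell_Rintegral_cst expr0 mul1r subrr mulr0 subr0.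
have bb : bounded_measurable (fun p : X3 => 1 - bump (weight n) (coord n p)).
  split.
    apply: measurable_funB => //.
    exact: measurableT_comp (measurable_bump (weight_ge0 n)) (measurable_coord al n).
  exists 1 => p; rewrite ger0_norm ?subr_ge0 ?bump_le1 ?weight_ge0 //.
  by rewrite gerBl bump_ge0 // weight_ge0.
apply: (@le_trans _ _ (cell_Rintegral (fun p => psi n p - (1 - bump (weight n) (coord n p))))).
  rewrite cell_RintegralB //; last exact: bounded_measurable_psi.
  rewrite (@cell_Rintegral_coord _ al (fun s => 1 - bump (weight n) s)); first last.
  - by move=> s m; rewrite bumpD.
  - exists 1 => s; rewrite ger0_norm ?subr_ge0 ?bump_le1 ?weight_ge0 //.
    by rewrite gerBl bump_ge0 // weight_ge0.
  - by apply: measurable_funB => //; exact: measurable_bump (weight_ge0 n).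
  have e : 2^-1 ^+ n = 2 * (2 ^+ n.+1)^-1 :> R.
    by rewrite exprVn [2 ^+ n.+1]exprS; field; rewrite expf_neq0.
  rewrite e in IH; rewrite exprVn.
  by have := Rintegral_bump_defect n; lra.
apply: le_cell_Rintegral.
- by apply: bounded_measurableB => //; exact: bounded_measurable_psi.
- exact: (bounded_measurable_psi n.+1).
move=> p; have /andP[a b] := psi01 n p.
have g0 := bump_ge0 (coord n p) (weight_ge0 n).
have g1 := bump_le1 (coord n p) (weight_ge0 n).
have := mulr_ge0 (_ : 0 <= 1 - psi n p) (_ : 0 <= 1 - bump (weight n) (coord n p)).
by rewrite !subr_ge0 => /(_ b g1); lra.
Qed.

End IntegralOfPsi.

End Potential.

(** b is the square root of al + 1, the growth rate of the minors.  The bound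
16 <= b gives the only smallness that is used, [ratio]: the steepness 4 b^2 per
step of grad psi_n times the rate b / (al - 1)^2 at which the slopes converge is
at most 1/2. *)
Section FieldEstimates.
Context {R : realType}.
Variable al b : R.
Local Notation mR := (measurableTypeR R).
Local Notation X3 := (mR * mR * mR)%type.
Implicit Types (p : X3) (d e : R * R * R) (t : R).
Local Notation coord := (coord al).
Local Notation sgn := (sgn al).
Local Notation tg d n p := (tang al (sgn p) d n).
Local Notation sl d n p := (slope al (sgn p) d n).
Local Notation psi := (psi al).
Local Notation dpsi := (dpsi al).
Local Notation curl := (curl al).
Local Notation dir := (@dir R).

Hypothesis b16 : 16 <= b.
Hypothesis bE : al + 1 = b ^+ 2.

Let b1 : 1 <= b. Proof. by move: b16; lra. Qed.

Let b2 : 256 <= b ^+ 2.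
Proof.
have h16 := b16; have : 0 <= (b - 16) * (b + 16) by apply: mulr_ge0; lra.
by rewrite expr2; lra.
Qed.

Lemma amplitude_ge3 : 3 <= al. Proof. by have := b2; rewrite -bE; lra. Qed.

Let al2 : 2 <= al. Proof. by have := amplitude_ge3; lra. Qed.

Lemma slope_dir0 n p : sl (dir 0) n.+2 p = 1.
Proof. by rewrite /slope divff // tang1_neq0 //; exact: normr_sgn. Qed.

Let al0 : 0 <= al. Proof. by have := al2; lra. Qed.

Let b0 : 0 < b. Proof. by move: b16; lra. Qed.

Let c := al - 1.

Let c0 : 0 < c. Proof. by rewrite /c; have := al2; lra. Qed.

Let ratio : 4 * b ^+ 3 / c ^+ 2 <= 2^-1.
Proof.
rewrite ler_pdivrMr ?exprn_gt0 //.
have -> : c = b ^+ 2 - 2 by rewrite /c -bE; ring.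
have [h16 h2] := (b16, b2); have : 0 <= b ^+ 2 * (b * (b - 8) - 4).
  apply: mulr_ge0; first lra.
  by have : 0 <= (b - 16) * (b + 8) by [apply: mulr_ge0; lra]; lra.
rewrite (_ : b ^+ 2 * (b * (b - 8) - 4) = b ^+ 4 - 8 * b ^+ 3 - 4 * b ^+ 2); last by ring.
by rewrite (_ : (b ^+ 2 - 2) ^+ 2 = b ^+ 4 - 4 * b ^+ 2 + 4); [lra | ring].
Qed.

Let dir_le i : [/\ `|(dir i).1.1| <= 1, `|(dir i).1.2| <= 1 & `|(dir i).2| <= 1].
Proof.
by case: i => [|[|i]] /=; rewrite ?normr0 ?normr1; split; rewrite ?ler01.
Qed.

Let tang_bound i n p : `|tg (dir i) n p| <= (b ^+ 2) ^+ n.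
Proof.
have [h1 h2 h3] := dir_le i.
by rewrite -[leRHS]mul1r; apply: tang_le => //; exact: normr_sgn.
Qed.

Let minor_bound i n p : `|minor al (sgn p) (dir i) (1, 0, 0) n| <= b ^+ n.
Proof.
apply: minor_le => //; first exact: normr_sgn; case: i => [|[|i]];
  rewrite /minor /= ?(mulr0, mul0r, mulr1, mul1r, subrr, subr0, sub0r, add0r, addr0,
    normr0, normrN, normr1, oppr0, ler01) //.
Qed.

Let slope_diff i n p : `|sl (dir i) n.+3 p - sl (dir i) n.+2 p| <=
  b ^+ 2 / c * (b / c ^+ 2) ^+ n.
Proof.
apply: slope_step => //; first exact: normr_sgn.
Qed.

Let pow_le n : (4 * b ^+ 3 / c ^+ 2) ^+ n <= (2 ^+ n)^-1.
Proof.
rewrite -exprVn; apply: lerXn2r; rewrite ?nnegrE ?invr_ge0 //.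
by rewrite !mulr_ge0 ?invr_ge0 ?exprn_ge0 // ltW.
Qed.

Let slope_diff_half i n p : `|sl (dir i) n.+3 p - sl (dir i) n.+2 p| <=
  b ^+ 2 / c / 2 ^+ n.
Proof.
apply: le_trans (slope_diff i n p) _; apply: ler_wpM2l.
  by rewrite mulr_ge0 ?invr_ge0 ?exprn_ge0 // ltW.
apply: le_trans (pow_le n); apply: lerXn2r.
- by rewrite nnegrE mulr_ge0 ?invr_ge0 ?exprn_ge0 // ltW.
- by rewrite nnegrE !mulr_ge0 ?invr_ge0 ?exprn_ge0 // ltW.
apply: ler_wpM2r; first by rewrite invr_ge0 exprn_ge0 // ltW.
rewrite -[leLHS]mul1r exprS mulrCA.
rewrite mulrC; apply: ler_wpM2l; first exact: ltW.
by have := b2; lra.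
Qed.

(** The slopes have summable increments: the bound is the one for a perturbed
contraction with factor 1. *)
Lemma slope_bound i : exists C : R, forall n p, `|sl (dir i) n.+2 p| <= C.
Proof.
exists (`|(dir i).1.1| + 2 * (b ^+ 2 / c)) => n p.
have := @perturbed_contraction_bound _ (fun n => sl (dir i) n.+2 p)
  (fun=> 1) (fun n => sl (dir i) n.+3 p - sl (dir i) n.+2 p) (b ^+ 2 / c).
move=> /(_ _ _ _ n) H; apply: le_trans (H _ _ _) _.
- by move=> m; rewrite mul1r addrC subrK.
- by move=> m; rewrite ler01 lexx.
- by move=> m; exact: slope_diff_half.
by rewrite lerD2r /slope /= divr1.
Qed.

Let W : R := weight 0 * 4.

Let W0 : 0 <= W. Proof. by rewrite mulr_ge0 // weight_ge0. Qed.

Let weightE n : weight n * 4 = W * 4 ^+ n.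
Proof.
have -> : (4 : R) = 2 ^+ 2 by rewrite expr2; ring.
by rewrite /W /weight expr0 mulr1 exprMn -!exprM mulnC; ring.
Qed.

Let dpsi_bound i n p : `|dpsi (dir i) n p| <= W * (4 * b ^+ 2) ^+ n.
Proof.
elim: n => [|n IH]; first by rewrite normr0 expr0 mulr1.
apply: le_trans (ler_normD _ _) _.
have X0 : 0 <= (4 * b ^+ 2) ^+ n by rewrite exprn_ge0 // mulr_ge0 // exprn_ge0 // ltW.
have step1 : `|dpsi (dir i) n p * bump (weight n) (coord n p)| <=
    W * (4 * b ^+ 2) ^+ n.
  rewrite normrM (ger0_norm (bump_ge0 _ (weight_ge0 n))).
  apply: le_trans IH; apply: ler_piMr => //.
  exact: bump_le1 _ (weight_ge0 n).
have step2 : `|psi n p * (dbump (weight n) (coord n p) * tg (dir i) n p)| <=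
    W * (4 * b ^+ 2) ^+ n.
  have /andP[q0 q1] := psi01 al n p.
  rewrite normrM (ger0_norm q0) normrM.
  rewrite -[leRHS]mul1r; apply: ler_pM => //.
  rewrite exprMn mulrA -weightE.
  apply: ler_pM => //.
  apply: le_trans (dbump_le _ (weight_ge0 n)) _.
  by rewrite ler_wpM2l ?weight_ge0 //; have := pihalf_lt2 R; lra.
apply: le_trans (lerD step1 step2) _.
have h2 := b2; have : 0 <= W * ((b ^+ 2 - 1) * (4 * b ^+ 2) ^+ n).
  by apply: mulr_ge0 => //; apply: mulr_ge0 => //; lra.
have : 0 <= W * (4 * b ^+ 2) ^+ n by exact: mulr_ge0.
by rewrite [_ ^+ n.+1]exprS; lra.
Qed.

Let err i j n p : R :=
  sgn p 0 * (dpsi (dir i) n.+3 p * (sl (dir j) n.+3 p - sl (dir j) n.+2 p)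
    - dpsi (dir j) n.+3 p * (sl (dir i) n.+3 p - sl (dir i) n.+2 p)).

(* In the product rule for psi_{n+1} = psi_n g_n(P_n) the covector dP_n is
   proportional to its normalisation, so its contribution cancels in the
   antisymmetric expression [curl], up to the change of the slopes. *)
Let curl_step i j n p :
  curl (dir i) (dir j) n.+3 p =
  bump (weight n.+2) (coord n.+2 p) * curl (dir i) (dir j) n.+2 p
  + err i j n p.
Proof.
have a2 := tang1_neq0 (normr_sgn al p) al2 n.
have E k : tg (dir k) n.+2 p = tang al (sgn p) (1, 0, 0) n.+2 * sl (dir k) n.+2 p.
  by rewrite /slope mulrC divfK.
have D k : dpsi (dir k) n.+3 p =
  dpsi (dir k) n.+2 p * bump (weight n.+2) (coord n.+2 p) +
  psi n.+2 p * (dbump (weight n.+2) (coord n.+2 p) *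
     (tang al (sgn p) (1, 0, 0) n.+2 * sl (dir k) n.+2 p)) by rewrite -E.
by rewrite /err /curl /dpot !D; ring.
Qed.

Let C : R := 2 * W * (4 * b ^+ 2) ^+ 3 * (b ^+ 2 / c).

Let err_bound i j n p : `|err i j n p| <= C / 2 ^+ n.
Proof.
rewrite /err normrM normr_sgn mul1r; apply: le_trans (ler_normB _ _) _.
have H k l : `|dpsi (dir k) n.+3 p * (sl (dir l) n.+3 p - sl (dir l) n.+2 p)|
    <= W * (4 * b ^+ 2) ^+ 3 * (b ^+ 2 / c) * (4 * b ^+ 3 / c ^+ 2) ^+ n.
  rewrite normrM.
  apply: le_trans (ler_pM _ _ (dpsi_bound k n.+3 p) (slope_diff l n p)) _ => //.
  rewrite -[n.+3]add3n exprD.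
  have -> : 4 * b ^+ 3 / c ^+ 2 = (4 * b ^+ 2) * (b / c ^+ 2).
    by rewrite [RHS]mulrA; congr (_ / _); ring.
  rewrite [(4 * b ^+ 2 * (b / c ^+ 2)) ^+ n]exprMn.
  set x := (4 * b ^+ 2) ^+ n; set y := (b / c ^+ 2) ^+ n.
  by rewrite le_eqVlt; apply/orP; left; apply/eqP; ring.
apply: le_trans (lerD (H i j) (H j i)) _.
set Y := W * _ * _; have Y0 : 0 <= Y.
  by rewrite !mulr_ge0 ?invr_ge0 ?exprn_ge0 ?mulr_ge0 // ltW ?exprn_gt0.
rewrite (_ : C = 2 * Y); last by rewrite /C /Y; ring.
by have := ler_wpM2l Y0 (pow_le n); lra.
Qed.

Lemma curl_bound i j : exists K : R, forall n p,
  `|curl (dir i) (dir j) n.+2 p| <= K.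
Proof.
have [Ci hi] := slope_bound i; have [Cj hj] := slope_bound j.
exists (W * (4 * b ^+ 2) ^+ 2 * Cj + W * (4 * b ^+ 2) ^+ 2 * Ci + 2 * C) => n p.
have := @perturbed_contraction_bound _ (fun n => curl (dir i) (dir j) n.+2 p)
  (fun n => bump (weight n.+2) (coord n.+2 p)) (fun n => err i j n p) C.
move=> /(_ _ _ _ n) H; apply: le_trans (H _ _ _) _.
- by move=> m; exact: curl_step.
- by move=> m; rewrite bump_ge0 ?bump_le1 // weight_ge0.
- by move=> m; exact: err_bound.
rewrite lerD2r /curl /dpot -mulrBr normrM normr_sgn mul1r.
apply: le_trans (ler_normB _ _) _.
rewrite (normrM (dpsi (dir i) 2 p)) (normrM (dpsi (dir j) 2 p)).
by apply: lerD; apply: ler_pM => //; exact: dpsi_bound.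
Qed.

Lemma curl_cvg i j p : cvgn (fun n => curl (dir i) (dir j) n.+2 p).
Proof.
apply: (@perturbed_contraction_cvg _ _
  (fun n => bump (weight n.+2) (coord n.+2 p)) (fun n => err i j n p) C).
- by move=> m; exact: curl_step.
- by move=> m; rewrite bump_ge0 ?bump_le1 // weight_ge0.
- by move=> m; exact: err_bound.
Qed.

Lemma bounded_measurable_dpot i j n :
  bounded_measurable (fun p => dpot al (dir i) (dir j) n.+2 p).
Proof.
have [Cj hj] := slope_bound j; split.
  apply: measurable_funM; first exact: measurable_sgn.
  apply: measurable_funM; first exact: measurable_dpsi.
  exact: measurable_slope.
exists (W * (4 * b ^+ 2) ^+ n.+2 * Cj) => p.
rewrite /dpot normrM normr_sgn mul1r normrM.
by apply: ler_pM => //; exact: dpsi_bound.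
Qed.

End FieldEstimates.

Section PotentialSlope.
Context {R : realType}.
Variable al : R.
Local Notation pi := (@pi R).
Local Notation mR := (measurableTypeR R).
Local Notation X3 := (mR * mR * mR)%type.
Implicit Types (p : X3) (d e : R * R * R) (t : R).
Local Notation coord := (coord al).
Local Notation sgn := (sgn al).
Local Notation tg d n p := (tang al (sgn p) d n).
Local Notation sl d n p := (slope al (sgn p) d n).
Local Notation psi := (psi al).
Local Notation dpsi := (dpsi al).

Definition lipschitz_bounded d (u : X3 -> R) := exists L B : R,
  (forall p t, `|u (move d t p) - u p| <= L * `|t|) /\ (forall p, `|u p| <= B).

Let lipschitz_boundedM d u v : lipschitz_bounded d u -> lipschitz_bounded d v ->
  lipschitz_bounded d (fun p => u p * v p).
Proof.
move=> [L [B [uL uB]]] [K [C [vK vC]]]; exists (B * K + L * C), (B * C).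
split=> p; last by rewrite normrM; apply: ler_pM.
move=> t; rewrite (_ : _ - _ = u (move d t p) * (v (move d t p) - v p) +
  (u (move d t p) - u p) * v p); last by ring.
apply: le_trans (ler_normD _ _) _; rewrite !normrM mulrDl; apply: lerD.
  by rewrite -mulrA; apply: ler_pM.
by rewrite mulrAC; apply: ler_pM.
Qed.

Let lipschitz_boundedD d u v : lipschitz_bounded d u -> lipschitz_bounded d v ->
  lipschitz_bounded d (fun p => u p + v p).
Proof.
move=> [L [B [uL uB]]] [K [C [vK vC]]]; exists (L + K), (B + C).
split=> p; last by apply: le_trans (ler_normD _ _) (lerD _ _).
move=> t; rewrite opprD addrACA mulrDl.
by apply: le_trans (ler_normD _ _) (lerD _ _).
Qed.

Let lipschitz_bounded_coord d n (c : R -> R) (L B : R) :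
  (forall s t, `|c s - c t| <= L * `|s - t|) -> (forall s, `|c s| <= B) ->
  lipschitz_bounded d (fun p => c (coord n p)).
Proof.
move=> cL cB; have [K hK] := coord_lipschitz al d n.
have L0 : 0 <= L.
  by have := le_trans (normr_ge0 _) (cL 1 0); rewrite subr0 normr1 mulr1.
exists (L * K), B; split=> p // t; apply: le_trans (cL _ _) _.
by rewrite -mulrA ler_wpM2l.
Qed.

Let bump_bounded (M s : R) : 0 <= M -> `|bump M s| <= 1.
Proof. by move=> M0; rewrite ger0_norm ?bump_ge0 ?bump_le1. Qed.

(* Both functions are Lipschitz in the coordinate, the second one by
   [bump_sign_lipschitz]; every function of the sign times the bump is a
   combination of the two. *)
Let lipschitz_bounded_bump d (M : R) n (k l : R) : 0 <= M ->
  lipschitz_bounded d (fun p => k * bump M (coord n p)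
    + l * (bump M (coord n p) * sgn p n)).
Proof.
move=> M0; pose c s := k * bump M s + l * (bump M s * slope_sign s).
apply: (@lipschitz_bounded_coord d n c (`|k| * (M * pi) + `|l| * (2 * (M * pi)))
  (`|k| + `|l|)).
  move=> s t; rewrite /c (_ : _ - _ = k * (bump M s - bump M t) +
    l * (bump M s * slope_sign s - bump M t * slope_sign t)); last by ring.
  apply: le_trans (ler_normD _ _) _; rewrite (normrM k) (normrM l) mulrDl -!mulrA.
  apply: lerD; apply: ler_wpM2l => //.
    by have := bump_lipschitz s t M0; rewrite -mulrA.
  by have := bump_sign_lipschitz s t M0; rewrite -!mulrA.
move=> s; apply: le_trans (ler_normD _ _) _.
rewrite (normrM k) (normrM l) (normrM (bump M s)) normr_slope_sign mulr1.
by apply: lerD; apply: ler_piMr => //; exact: bump_bounded.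
Qed.

(** The first n signs may enter in an arbitrary way, because each jump of a sign
is killed by its own bump.  The induction splits F according to the last sign. *)
Lemma lipschitz_bounded_psi d n (F : seq R -> R) :
  lipschitz_bounded d (fun p => psi n p * F (mkseq (sgn p) n)).
Proof.
elim: n F => [|n IH] F.
  exists 0, `|F [::]|; split=> [p t|p]; last by rewrite /= mul1r.
  by rewrite /= subrr normr0 mul0r.
pose F1 s := F (rcons s 1); pose F2 s := F (rcons s (- 1)).
have e (p : X3) : psi n.+1 p * F (mkseq (sgn p) n.+1) =
    psi n p * F1 (mkseq (sgn p) n) *
      (2^-1 * bump (weight n) (coord n p)
       + 2^-1 * (bump (weight n) (coord n p) * sgn p n)) +
    psi n p * F2 (mkseq (sgn p) n) *
      (2^-1 * bump (weight n) (coord n p)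
       + (- 2^-1) * (bump (weight n) (coord n p) * sgn p n)).
  rewrite /mkseq -addn1 iotaD map_cat cats1 /= add0n /F1 /F2 /mkseq.
  by rewrite addn1 /=; case: (sgn_pm al p n) => ->; field.
rewrite (funext e).
apply: lipschitz_boundedD; apply: lipschitz_boundedM => //;
  by apply: lipschitz_bounded_bump; exact: weight_ge0.
Qed.

Let pot_signs e n p : pot al e n.+1 p = psi n.+1 p *
  (fun s => nth 0 s 0 * slope al (nth 0 s) e n.+1) (mkseq (sgn p) n.+1).
Proof.
have E d : tg d n.+1 p = tang al (nth 0 (mkseq (sgn p) n.+1)) d n.+1.
  by apply: eq_tang => j jn; rewrite nth_mkseq.
by rewrite /pot /slope !E nth_mkseq // mulrCA mulrA.
Qed.

Lemma lipschitz_bounded_pot d e n : lipschitz_bounded d (pot al e n.+1).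
Proof.
rewrite (funext (pot_signs e n)).
exact: (lipschitz_bounded_psi d n.+1
  (fun s => nth 0 s 0 * slope al (nth 0 s) e n.+1)).
Qed.

(* The coordinates of p of rank less than n avoid the corners of h, and they are
   continuous along the line. *)
Let sgn_near d p n : (forall j, ~ Sigma (coord j p)) ->
  \forall t \near (0 : R), forall j, (j < n)%N -> sgn (move d t p) j = sgn p j.
Proof.
move=> nS; elim: n => [|n IH]; first by near=> t.
have cn : (fun t => coord n (move d t p)) @ (0 : R) --> coord n p.
  have D := coord_is_derive d (fun j (_ : (j < n)%N) => nS j).
  have H : (fun t => coord n (move d t p)) @ (0 : R) --> coord n (move d 0 p).
    have Df : differentiable (fun t => coord n (move d t p) : R) (0 : R).
      by apply/derivable1_diffP; case: D.
    exact: (differentiable_continuous Df).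
  by rewrite move0 in H.
have Hn : \forall t \near (0 : R), sgn (move d t p) n = sgn p n.
  have cS := cn _ (h_near (nS n)).
  near=> t; apply: (proj2 (A := h (coord n (move d t p)) = h (coord n p) +
    slope_sign (coord n p) * (coord n (move d t p) - coord n p))).
  by near: t.
apply: filterS2 IH Hn => t IH Hn j; rewrite ltnS leq_eqVlt => /orP[/eqP->//|].
exact: IH.
Unshelve. all: by end_near. Qed.

Let sgn_is_derive d p j : (forall j, ~ Sigma (coord j p)) ->
  is_derive (0 : R) (1 : R) (fun t => sgn (move d t p) j) 0.
Proof.
move=> nS; apply: (near_eq_is_derive _ (is_derive_cst (sgn p j) (0 : R) 1)).
by apply: filterS (sgn_near d j.+1 nS) => t ->.
Qed.

Let slope_is_derive d e p n : (forall j, ~ Sigma (coord j p)) ->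
  is_derive (0 : R) (1 : R) (fun t => sl e n (move d t p)) 0.
Proof.
move=> nS; apply: (near_eq_is_derive _ (is_derive_cst (sl e n p) (0 : R) 1)).
apply: filterS (sgn_near d n nS) => t H.
by rewrite /slope; congr (_ / _); apply: eq_tang => j jn; rewrite H.
Qed.

Let psi_is_derive d p n : (forall j, ~ Sigma (coord j p)) ->
  is_derive (0 : R) (1 : R) (fun t => psi n (move d t p)) (dpsi d n p).
Proof.
move=> nS; elim: n => [|n IH] /=; first exact: is_derive_cst.
have Db := bump_is_derive (weight_ge0 n) (nS n).
have Dn := coord_is_derive d (fun j (_ : (j < n)%N) => nS j).
have Dc := is_derive_comp_coord Db Dn.
by have := is_derive_prod IH Dc; rewrite !move0 /= -mulrA.
Qed.

Let pot_is_derive d e p n : (forall j, ~ Sigma (coord j p)) ->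
  is_derive (0 : R) (1 : R) (fun t => pot al e n (move d t p)) (dpot al d e n p).
Proof.
move=> nS; have D1 := sgn_is_derive d 0 nS; have D2 := psi_is_derive d n nS.
have D3 := slope_is_derive d e n nS.
have D := is_derive_prod D1 (is_derive_prod D2 D3).
by rewrite !move0 mul0r add0r mulr0 addr0 in D; exact: D.
Qed.

Lemma slope_along_pot d e n : bounded_measurable (dpot al d e n.+1) ->
  slope_along d (pot al e n.+1) (dpot al d e n.+1).
Proof.
move=> bd; have [L [B [hL hB]]] := lipschitz_bounded_pot d e n; split => //.
- split; last by exists B.
  apply: measurable_funM; first exact: measurable_sgn.
  by apply: measurable_funM; [exact: measurable_psi | exact: measurable_slope].
- move=> p m1 m2 m3; congr (_ * (_ * _)).
  + exact: periodic3_sgn.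
  + exact: periodic3_psi.
  + exact: periodic3_slope.
- by exists L.
- by apply: filterS (ae_coord al) => p nS; exact: pot_is_derive.
Qed.

End PotentialSlope.

(** * The differential of the map and the unstable planes *)

Section Differential.
Context {R : realType}.
Variable al : R.
Local Notation rV3 := 'rV[R]_3.
Local Notation mR := (measurableTypeR R).
Local Notation X3 := (mR * mR * mR)%type.
Implicit Types (x v : rV3) (p : X3).

Definition trip x : X3 := (xc x, yc x, zc x).

Lemma vec3E (a b c : R) : [/\ xc (vec3 a b c) = a, yc (vec3 a b c) = b &
  zc (vec3 a b c) = c].
Proof. by rewrite /xc /yc /zc /vec3 !mxE. Qed.

Lemma trip_vec3 a b c : trip (vec3 a b c) = (a, b, c).
Proof. by rewrite /trip; case: (vec3E a b c) => -> -> ->. Qed.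

Lemma tripK x : pt (trip x) = x.
Proof.
apply/rowP => j; rewrite /pt /vec3 mxE /trip /xc /yc /zc /=.
by case: j => [[|[|[|//]]] jlt] /=; congr (x _ _); exact: val_inj.
Qed.

Lemma ptK p : trip (pt p) = p.
Proof. by rewrite /pt trip_vec3; case: p => [[a b] c]. Qed.

Lemma vec3_entry (u : nat -> R) (i : 'I_3) :
  vec3 (u 0%N) (u 1%N) (u 2%N) 0 i = u i.
Proof. by rewrite /vec3 mxE; case: i => [[|[|[|]]]]. Qed.

Lemma sum3 (F : 'I_3 -> R) : \sum_i F i = F (inord 0) + F (inord 1) + F (inord 2).
Proof.
rewrite !big_ord_recl big_ord0 addr0 addrA.
by congr (F _ + F _ + F _); apply: val_inj; rewrite /= inordK.
Qed.

Lemma T_step x : trip (T al x) = step al (step al (step al (trip x))).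
Proof.
rewrite /T /= /T3 /T2 /T1 trip_vec3.
case: (vec3E (xc x + al * h (yc x)) (yc x) (zc x)) => -> -> ->.
by case: (vec3E (xc x + al * h (yc x)) (yc x + al * h (zc x)) (zc x)) => -> -> ->.
Qed.

(** The differential of T off its singular set, by the chain rule. *)
Definition dT x v : rV3 :=
  let x1 := xc v + al * (slope_sign (yc x) * yc v) in
  vec3 x1 (yc v + al * (slope_sign (zc x) * zc v))
    (zc v + al * (slope_sign (xc x + al * h (yc x)) * x1)).

Let TE x : T al x = (xc x + al * h (yc x)) *: vec3 1 0 0 +
  (yc x + al * h (zc x)) *: vec3 0 1 0 +
  (zc x + al * h (xc x + al * h (yc x))) *: vec3 0 0 1.
Proof.
rewrite /T /= /T3 /T2 /T1.
case: (vec3E (xc x + al * h (yc x)) (yc x) (zc x)) => -> -> ->.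
case: (vec3E (xc x + al * h (yc x)) (yc x + al * h (zc x)) (zc x)) => -> -> ->.
apply/rowP => j; rewrite /vec3 !mxE.
by case: j => [[|[|[|//]]] jlt] /=; rewrite !mulr1 !mulr0 !(addr0, add0r).
Qed.

Let is_diff_entry (j : 'I_3) x : is_diff x (fun v : rV3 => v 0 j : R) (fun v => v 0 j).
Proof.
have L : linear (fun v : rV3 => v 0 j : R) by move=> a u v; rewrite !mxE.
pose Lm := GRing.isLinear.Build _ _ _ _ _ L.
pose f : {linear rV3 -> R} := HB.pack (fun v : rV3 => v 0 j : R) Lm.
apply: DiffDef; first exact: differentiable_coord.
apply: (@diff_lin _ _ _ f) => y.
exact: (differentiable_continuous (differentiable_coord y 0 j)).
Qed.

Let is_diff_h (w dw : rV3 -> R) x : ~ Sigma (w x) -> is_diff x w dw ->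
  is_diff x (fun q => h (w q)) (fun v => slope_sign (w x) * dw v).
Proof.
move=> nS dwx; have [dh eh] := h_is_derive nS.
have dd : is_diff (w x) (@h R) (fun s => slope_sign (w x) * s).
  apply: DiffDef; first exact/derivable1_diffP.
  rewrite diff1E; last exact/derivable1_diffP.
  by rewrite derive1E eh; apply/funext => s; rewrite /GRing.scale /= mulrC.
exact: (is_diff_comp dwx dd).
Qed.

Let is_diff_shear (u du w dw : rV3 -> R) x : is_diff x u du -> ~ Sigma (w x) ->
  is_diff x w dw ->
  is_diff x (fun q => u q + al * h (w q)) (fun v => du v + al * (slope_sign (w x) * dw v)).
Proof.
move=> dux nS dwx; have dh := is_diff_h nS dwx.
have H := @is_diffD _ _ _ u (al *: (fun q => h (w q))) _ _ x dux (is_diffZ al dh).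
exact: H.
Qed.

Let is_diff_scal (k dk : rV3 -> R) (f : rV3) x : is_diff x k dk ->
  is_diff x (fun q => k q *: f) (fun v => dk v *: f).
Proof.
move=> [dkx <-]; apply: DiffDef; first exact: differentiableZl.
by rewrite diffZl.
Qed.

Lemma is_diff_T x : ~ Sigma (yc x) -> ~ Sigma (zc x) ->
  ~ Sigma (xc x + al * h (yc x)) -> is_diff x (T al) (dT x).
Proof.
move=> ny nz nx.
have d1 : is_diff x (fun q : rV3 => xc q + al * h (yc q))
    (fun v => xc v + al * (slope_sign (yc x) * yc v)).
  by apply: is_diff_shear => //; exact: is_diff_entry.
have d2 : is_diff x (fun q : rV3 => yc q + al * h (zc q))
    (fun v => yc v + al * (slope_sign (zc x) * zc v)).
  by apply: is_diff_shear => //; exact: is_diff_entry.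
have d3 : is_diff x (fun q : rV3 => zc q + al * h (xc q + al * h (yc q)))
    (fun v => zc v + al * (slope_sign (xc x + al * h (yc x)) *
      (xc v + al * (slope_sign (yc x) * yc v)))).
  apply: is_diff_shear => //; exact: is_diff_entry.
have e1 := is_diff_scal (vec3 1 0 0) d1.
have e2 := is_diff_scal (vec3 0 1 0) d2.
have e3 := is_diff_scal (vec3 0 0 1) d3.
have [df eD] := is_diffD (is_diffD e1 e2) e3.
have eT : T al = (fun q => (xc q + al * h (yc q)) *: vec3 1 0 0) +
  (fun q => (yc q + al * h (zc q)) *: vec3 0 1 0) +
  (fun q => (zc q + al * h (xc q + al * h (yc q))) *: vec3 0 0 1).
  by apply/funext => q; rewrite TE.
rewrite eT; apply: DiffDef; first exact: df.
rewrite eD; apply/funext => v; apply/rowP => j.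
rewrite /dT /vec3 !mxE.
by case: j => [[|[|[|//]]] jlt] /=; rewrite !mulr1 !mulr0 !(addr0, add0r).
Qed.

End Differential.

Section UnstableBundle.
Context {R : realType}.
Variable al b : R.
Local Notation rV3 := 'rV[R]_3.
Implicit Types (x v w : rV3).
Hypothesis b16 : 16 <= b.
Hypothesis bE : al + 1 = b ^+ 2.

Let al3 : 3 <= al := amplitude_ge3 b16 bE.

Let al2 : 2 <= al. Proof. by have := al3; lra. Qed.

Definition Tinv x : rV3 := pt (unstep al (unstep al (unstep al (trip x)))).

Lemma TinvK x : T al (Tinv x) = x.
Proof.
rewrite -[LHS]tripK T_step /Tinv ptK !unstepK.
exact: tripK.
Qed.

Lemma regular_not_singular x : regular al x -> ~ singular al x.
Proof. by move=> rx sx; apply: rx; exists 0%N => //; right. Qed.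

Lemma regular_Tinv x : regular al x -> regular al (Tinv x).
Proof.
move=> rx [m _ [[s ss e]|e]]; apply: rx.
  by exists m.+1 => //; left; exists s => //=; rewrite e TinvK.
case: m e => [|m] /= e.
  by exists 1%N => //; left; exists (Tinv x) => //=; rewrite TinvK.
exists m => //; right; move: e.
by rewrite -[T al (iter m _ _)]/(iter m.+1 (T al) (Tinv x)) iterSr TinvK.
Qed.

(** The backward coordinates of T x of rank n + 3 are those of x of rank n; this is
the corresponding identity for their differentials. *)
Lemma tang_dT x v n :
  tang al (sgn al (trip (T al x))) (xc (dT al x v), yc (dT al x v), zc (dT al x v)) n.+3
  = tang al (sgn al (trip x)) (xc v, yc v, zc v) n.
Proof.
have sg j : sgn al (trip (T al x)) j.+3 = sgn al (trip x) j.
  by rewrite /sgn T_step -!coord_unstep !stepK.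
have s2 : sgn al (trip (T al x)) 2 = slope_sign (xc x + al * h (yc x)).
  by rewrite /sgn T_step.
case: (vec3E (xc v + al * (slope_sign (yc x) * yc v))
  (yc v + al * (slope_sign (zc x) * zc v))
  (zc v + al * (slope_sign (xc x + al * h (yc x)) *
     (xc v + al * (slope_sign (yc x) * yc v))))) => e1 e2 e3.
rewrite /dT e1 e2 e3.
elim/nat_ind3: n => [|||n IH0 IH1 IH2].
- by rewrite tangS s2 /=; ring.
- rewrite tangS sg tangS s2 /= -[sgn al (trip x) 0]/(slope_sign (zc x)).
  by ring.
- rewrite !tangS !sg s2 /= -[sgn al (trip x) 0]/(slope_sign (zc x))
    -[sgn al (trip x) 1]/(slope_sign (yc x)).
  by ring.
by rewrite tangS IH0 sg IH2.
Qed.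

Lemma tang_linear s (x y z : R) n : tang al s (x, y, z) n =
  x * tang al s (1, 0, 0) n + y * tang al s (0, 1, 0) n
  + z * tang al s (0, 0, 1) n.
Proof.
elim/nat_ind3: n => [|||n IH0 IH1 IH2]; rewrite ?tangS; try by move=> /=; ring.
by rewrite IH0 IH2; ring.
Qed.

Lemma abs_xc_le_enorm v : `|xc v| <= enorm v.
Proof.
rewrite /enorm -sqrtr_sqr ler_sqrt; last by apply: sumr_ge0 => i _; exact: sqr_ge0.
by rewrite (bigD1 0) //= lerDl; apply: sumr_ge0 => i _; exact: sqr_ge0.
Qed.

Variables (Lu Ls kappa : R) (Eu Es : rV3 -> {vspace rV3}).
Hypothesis H : hyperbolic_splitting al Lu Ls kappa Eu Es.

(** Invariance provides a preimage under DT, and expansion, whose rate exceeds 1,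
says that it is not longer. *)
Lemma Eu_pullback x w : regular al x -> w \in Eu x ->
  exists2 u, u \in Eu (Tinv x) & w = dT al (Tinv x) u /\ enorm u <= enorm w.
Proof.
move=> rx wx; have ry := regular_Tinv rx.
have [ny nz nx] : [/\ ~ Sigma (yc (Tinv x)), ~ Sigma (zc (Tinv x)) &
    ~ Sigma (xc (Tinv x) + al * h (yc (Tinv x)))].
  by have := regular_not_singular ry; rewrite /singular /=; split=> ?; tauto.
have [dT1 dT2] := is_diff_T ny nz nx.
have DTE u : DT al 1 (Tinv x) u = dT al (Tinv x) u by rewrite -dT2.
have := Eu_invariant H ry; rewrite TinvK => e.
move: wx; rewrite -e => /memv_imgP [u ux ->].
have -> : linfun (DT al 1 (Tinv x)) u = dT al (Tinv x) u.
  by rewrite -dT2; exact: (lfunE ('d (T al) (Tinv x))).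
exists u => //; split => //.
have := Eu_expand H 1 ry ux; rewrite expr1 DTE; apply: le_trans.
by apply: ler_peMl; [exact: sqrtr_ge0 | exact/ltW/(Lu_gt1 H)].
Qed.

(** Pull back w along n steps of T: the differential of the coordinate of rank
3 n + 2 at x becomes the first entry of a vector not longer than w. *)
Lemma Eu_tang n x w : regular al x -> w \in Eu x ->
  `|tang al (sgn al (trip x)) (xc w, yc w, zc w) (3 * n).+2| <= enorm w.
Proof.
elim: n x w => [|n IH] x w rx wx; first by rewrite muln0 /=; exact: abs_xc_le_enorm.
have [u ux [wE un]] := Eu_pullback rx wx.
rewrite mulnS -[(3 + 3 * n).+2]/(3 * n).+2.+3 -{1}(TinvK x) wE tang_dT -wE.
by apply: le_trans (IH _ _ (regular_Tinv rx) ux) un.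
Qed.

Let sl i n x := slope al (sgn al (trip x)) (dir i) n.

(** A bounded quantity divided by the x-component of the covector, which is at
least (al - 1)^(3 n). *)
Lemma Eu_slope x w : regular al x -> w \in Eu x ->
  (fun n => xc w + yc w * sl 1 (3 * n).+2 x + zc w * sl 2 (3 * n).+2 x)
    @ \oo --> (0 : R).
Proof.
move=> rx wx.
have c1 : `|(al - 1)^-1| < 1.
  rewrite ger0_norm ?invr_ge0; last by have := al3; lra.
  by rewrite invf_lt1; have := al3; lra.
have c2 : (fun n => enorm w * (al - 1)^-1 ^+ n) @ \oo --> (0 : R).
  by rewrite -(mulr0 (enorm w)); apply: cvgMr; exact: cvg_expr.
apply/norm_cvg0P; apply: (squeeze_cvgr _ (cvg_cst 0) c2).
apply: nearW => n; rewrite normr_ge0 /=.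
have a0 := tang1_neq0 (normr_sgn al (trip x)) al2 (3 * n).
rewrite (_ : _ + _ = tang al (sgn al (trip x)) (xc w, yc w, zc w) (3 * n).+2 /
    tang al (sgn al (trip x)) (1, 0, 0) (3 * n).+2); last first.
  by rewrite tang_linear /sl /slope /dir; field.
rewrite normrM; apply: ler_pM => //; first exact: Eu_tang.
rewrite normfV exprVn lef_pV2 ?posrE ?normr_gt0 //; last first.
  by apply: exprn_gt0; have := al3; lra.
apply: le_trans (tang1_ge (normr_sgn al (trip x)) al2 (3 * n)).
by apply: ler_weXn2l; [have := al3; lra | rewrite leq_pmull].
Qed.

(** By [Eu_slope] a vector of E^u with y = z = 0 also has x = 0, so the projection
to the (y, z)-plane is injective on E^u, hence onto as E^u is a plane. *)
Lemma Eu_graph x (y z : R) : regular al x -> exists2 w, w \in Eu x & yc w = y /\ zc w = z.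
Proof.
move=> rx; pose f : 'Hom(rV3, 'rV[R]_2) := linfun (col' (0 : 'I_3)).
have ker0 : (Eu x :&: lker f = 0)%VS.
  apply/eqP; rewrite -subv0; apply/subvP => w; rewrite memv_cap memv_ker => /andP[wx].
  rewrite lfunE /= => /eqP /rowP fw.
  have yw : yc w = 0.
    by have := fw 0; rewrite !mxE => <-; congr (w _ _); exact: val_inj.
  have zw : zc w = 0.
    by have := fw 1; rewrite !mxE => <-; congr (w _ _); exact: val_inj.
  have := Eu_slope rx wx; rewrite yw zw.
  under eq_fun do rewrite !mul0r !addr0.
  move=> /(cvg_lim (@Rhausdorff R)); rewrite lim_cst // => xw.
  by rewrite memv0 -[w]tripK /trip xw yw zw; apply/eqP/rowP => j;
    rewrite /pt /vec3 !mxE; case: j => [[|[|[|//]]] jlt].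
have full : (f @: Eu x)%VS = fullv.
  apply/eqP; rewrite eqEdim subvf /= limg_dim_eq // (Eu_dim H rx) dimvf.
  by rewrite /dim /= mul1n.
have : \row_(j < 2) (if j == 0 then y else z) \in (f @: Eu x)%VS.
  by rewrite full memvf.
move=> /memv_imgP [w wx]; rewrite lfunE /= => /rowP e; exists w => //.
split.
  by have := e 0; rewrite !mxE /= => ->; congr (w _ _); exact: val_inj.
by have := e 1; rewrite !mxE /= => ->; congr (w _ _); exact: val_inj.
Qed.

End UnstableBundle.

(** * Test functions *)

Section TestFunctions.
Context {R : realType}.
Local Notation pi := (@pi R).
Local Notation mR := (measurableTypeR R).
Local Notation X3 := (mR * mR * mR)%type.
Local Notation rV3 := 'rV[R]_3.
Implicit Types (p : X3) (x v : rV3) (phi : rV3 -> R).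

Lemma measurable_comp_countable (C : countType) (G : X3 -> C) (F : C -> mR) :
  (forall k, measurable (G @^-1` [set k])) -> measurable_fun setT (F \o G).
Proof.
move=> mG _ Y mY; rewrite setTI.
rewrite (_ : _ @^-1` Y = \bigcup_k (if F k \in Y then G @^-1` [set k] else set0)).
  by apply: countable_bigcupT_measurable => // k; case: ifP.
apply/seteqP; split => p /=.
  by move=> Yp; exists (G p) => //; rewrite mem_set.
by move=> [k _]; case: ifP => //; rewrite inE => Yk ->.
Qed.

Let round (n : nat) (s : R) : int := Num.floor (n.+1%:R * s).

Let unround (n : nat) (k : int) : R := k%:~R / n.+1%:R.

Let measurable_round n (k : int) : measurable [set s : mR | round n s = k].
Proof.
have mfl : measurable_fun [set: mR] ((fun s => (Num.floor s)%:~R) : mR -> mR).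
  by apply: nondecreasing_measurable => // s t; rewrite ler_int; exact: le_floor.
have mf : measurable_fun [set: mR] ((fun s => (round n s)%:~R) : mR -> mR).
  by apply: (measurableT_comp mfl); exact: measurable_funM.
rewrite (_ : [set s : mR | _] =
    setT `&` (fun s : mR => (round n s)%:~R : mR) @^-1` [set k%:~R]).
  by apply: mf => //; exact: measurable_set1.
rewrite setTI; apply/seteqP; split => s; first by move=> /= <-.
by move=> /= /intr_inj.
Qed.

Let cvg_round (s : R) : (fun n => unround n (round n s)) @ \oo --> s.
Proof.
apply/cvgrPdist_le => e e0; near=> n.
have n0 : 0 < n.+1%:R :> R by [].
have /andP[] := floor_itv (n.+1%:R * s); rewrite intrD => h1 h2.
have n1 : n.+1%:R^-1 <= e.
  by near: n; have := near_infty_natSinv_lt (PosNum e0); apply: filterS => k /ltW.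
apply: le_trans n1; rewrite /unround /round.
set k := (Num.floor _)%:~R in h1 h2 *.
rewrite (_ : s - k / n.+1%:R = (n.+1%:R * s - k) / n.+1%:R); last first.
  by field; rewrite gt_eqF.
rewrite normrM normfV (gtr0_norm n0) -[leRHS]mul1r ler_pM2r ?invr_gt0 //.
by rewrite ger0_norm; lra.
Unshelve. all: by end_near. Qed.

Let ptE p : pt p = p.1.1 *: vec3 1 0 0 + p.1.2 *: vec3 0 1 0 + p.2 *: vec3 0 0 1.
Proof.
apply/rowP => j; rewrite /pt /vec3 !mxE.
by case: j => [[|[|[|//]]] jlt] /=; rewrite !mulr1 !mulr0 !(addr0, add0r).
Qed.

(** The topology used for continuity is that of row vectors, while measurability
is for the product of three lines.  Rounding the coordinates
to multiples of 1 / (n + 1) writes phi as a limit of functions of countably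
many values, which are measurable for elementary reasons. *)
Lemma measurable_continuous_pt phi : continuous phi ->
  measurable_fun setT (fun p => phi (pt p) : mR).
Proof.
move=> cphi.
pose G n (p : X3) : int * int * int := (round n p.1.1, round n p.1.2, round n p.2).
pose F n (k : int * int * int) : mR :=
  phi (pt (unround n k.1.1, unround n k.1.2, unround n k.2)).
have mG n k : measurable (G n @^-1` [set k]).
  case: k => [[k1 k2] k3].
  have mI (f : X3 -> mR) k : measurable_fun setT f ->
      measurable [set p | round n (f p) = k].
    move=> mf; rewrite -[X in measurable X]setTI.
    exact: (mf measurableT _ (measurable_round n k)).
  rewrite (_ : _ @^-1` _ = [set p | round n p.1.1 = k1] `&`
      [set p | round n p.1.2 = k2] `&` [set p | round n p.2 = k3]).
    apply: measurableI; first apply: measurableI.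
    - exact: (mI _ _ (@measurable_px R)).
    - exact: (mI _ _ (@measurable_py R)).
    - exact: (mI _ _ (@measurable_pz R)).
  apply/seteqP; split => p; last by rewrite /G /= => -[[-> ->] ->].
  by rewrite /G /= => e; split; [split|]; case: e.
apply: (measurable_fun_cvg (h := fun n => F n \o G n)) => //.
  by move=> n; exact: measurable_comp_countable.
move=> p _.
have c : (fun n => pt (unround n (round n p.1.1), unround n (round n p.1.2),
    unround n (round n p.2))) @ \oo --> pt p.
  rewrite (ptE p) (_ : (fun n => pt _) = fun n =>
    unround n (round n p.1.1) *: vec3 1 0 0 +
    unround n (round n p.1.2) *: vec3 0 1 0 +
    unround n (round n p.2) *: vec3 0 0 1); last first.
    by apply/funext => n; rewrite ptE.
  apply: cvgD; first apply: cvgD; apply: cvgZr_tmp; exact: cvg_round.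
exact: (cvg_comp _ _ c (cphi (pt p))).
Qed.

Lemma periodic3_pt phi : Defs.periodic phi -> periodic3 (fun p => phi (pt p)).
Proof.
move=> pphi p m1 m2 m3.
rewrite -[RHS](pphi _ (fun i : 'I_3 => nth 0 [:: m1; m2; m3] i)) //.
congr phi; apply/rowP => j; rewrite /pt /vec3 !mxE.
by case: j => [[|[|[|//]]] jlt] /=.
Qed.

(** Every point has a translate in the compact cube [0, 2 pi]^3. *)
Lemma bounded_continuous_periodic phi : continuous phi -> Defs.periodic phi ->
  exists C : R, forall x, `|phi x| <= C.
Proof.
move=> cphi pphi.
have p0 : 0 <= 2 * pi by rewrite mulr_ge0 // pi_ge0.
pose A : set rV3 := [set v | forall i, `[0, 2 * pi]%classic (v ord0 i)].
have cA : compact A.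
  apply: (@rV_compact _ _ (fun=> `[0, 2 * pi]%classic)) => i.
  exact: segment_compact.
have A0 : A !=set0 by exists 0 => i; rewrite /= mxE in_itv /= lexx p0.
have cn : {within A, continuous (fun x => `|phi x|)}.
  apply: continuous_subspaceT => x; apply: cvg_comp (cphi x) _.
  exact: norm_continuous.
have [c _ cmax] := EVT_max_rV A0 cA cn.
exists `|phi c| => x.
pose k (i : 'I_3) : int := - Num.floor (x 0 i / (2 * pi)).
rewrite -(pphi x k) //; apply: cmax; rewrite inE => i /=.
rewrite !mxE /k mulrNz mulNr -/(frac2pi (x 0 i)) in_itv /=.
by have /andP[-> /ltW ->] := frac2pi_bounds (x 0 i).
Qed.

Definition dirv (i : 'I_3) : rV3 := delta_mx 0 i.

Lemma pt_move (i : 'I_3) p t : pt (move (dir i) t p) = t *: dirv i + pt p.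
Proof.
apply/rowP => j; rewrite /pt /vec3 !mxE /move.
by case: i => [[|[|[|//]]] ilt]; case: j => [[|[|[|//]]] jlt] /=;
  rewrite ?mulr1 ?mulr0 ?(addr0, add0r) // addrC.
Qed.

Lemma is_derive_line phi x v t : (forall y, differentiable phi y) ->
  is_derive (t : R) (1 : R) (fun s => phi (s *: v + x)) ('D_v phi (t *: v + x)).
Proof.
move=> dphi.
have dg : is_diff t (fun s : R => s *: v + x) (fun s => s *: v).
  have H := is_diffD (is_diff_scalel t v) (is_diff_cst x t).
  by apply: (is_diff_eq H); rewrite addr0.
have dd : differentiable (fun s : R => s *: v + x) t by case: dg.
apply: DeriveDef.
  apply/derivable1_diffP; exact: (differentiable_comp dd (dphi _)).
rewrite deriveE; last exact: (differentiable_comp dd (dphi _)).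
rewrite (diff_comp dd (dphi _)) /= (diff_val (is_diff_def := dg)) scale1r.
by rewrite -deriveE.
Qed.

Lemma partial_periodic i phi : Defs.periodic phi -> Defs.periodic (partial i phi).
Proof.
move=> pphi x k _; rewrite /partial /derive.
set g1 := fun t => t^-1 *: _; set g2 := fun t => t^-1 *: _.
suff -> : g1 = g2 by [].
by apply/funext => t; rewrite /g1 /g2 /= addrA !pphi.
Qed.

(** The Lipschitz bound is the mean value inequality along a line, with a bound
for the partial derivative that comes from periodicity. *)
Lemma slope_along_test (i : 'I_3) phi : Defs.periodic phi -> smooth phi ->
  slope_along (dir i) (fun p => phi (pt p)) (fun p => partial i phi (pt p)).
Proof.
move=> pphi sphi.
have dphi y : differentiable phi y by exact: (sphi [::]).
have dpart y : differentiable (partial i phi) y by exact: (sphi [:: i]).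
have cphi : continuous phi by move=> y; exact: differentiable_continuous.
have cpart : continuous (partial i phi) by move=> y; exact: differentiable_continuous.
have ppart := partial_periodic i pphi.
have [K hK] := bounded_continuous_periodic cpart ppart.
have [C hC] := bounded_continuous_periodic cphi pphi.
have line (x : rV3) t := is_derive_line x (dirv i) t dphi.
split.
- by split; [exact: measurable_continuous_pt | exists C].
- exact: periodic3_pt.
- exists K => p t; rewrite pt_move.
  pose f (s : R) := phi (s *: dirv i + pt p).
  have f0 : phi (pt p) = f 0 by rewrite /f scale0r add0r.
  have cf : continuous f.
    by move=> s; apply/differentiable_continuous/derivable1_diffP; case: (line (pt p) s).
  rewrite f0 -/(f t).
  have key (a b : R) : a <= b -> `|f b - f a| <= K * `|b - a|.
    move=> ab; have [c _ ->] := MVT_segment ab (fun s _ => line (pt p) s)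
      (continuous_subspaceT cf).
    by rewrite normrM ler_wpM2r //; exact: hK.
  have [t0|t0] := leP 0 t; first by have := key 0 t t0; rewrite subr0.
  by have := key t 0 (ltW t0); rewrite distrC sub0r normrN.
- by split; [exact: measurable_continuous_pt | exists K].
apply: aeW => p; have := line (pt p) 0; rewrite scale0r add0r.
rewrite (_ : (fun t => phi (pt _)) = (fun s => phi (s *: dirv i + pt p))) //.
by apply/funext => t; rewrite pt_move.
Qed.

Lemma slope_alongM d (u v u' v' : X3 -> mR) :
  slope_along d u u' -> slope_along d v v' ->
  slope_along d (fun p => u p * v p) (fun p => u' p * v p + u p * v' p).
Proof.
move=> [bu pu [L uL] bu' du] [bv pv [K vK] bv' dv].
have [_ [C uC]] := bu; have [_ [D vD]] := bv.
split.
- exact: bounded_measurableM.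
- by move=> p m1 m2 m3; rewrite pu pv.
- exists (C * K + L * D) => p t.
  rewrite (_ : _ - _ = u (move d t p) * (v (move d t p) - v p) +
    (u (move d t p) - u p) * v p); last by ring.
  apply: le_trans (ler_normD _ _) _; rewrite !normrM mulrDl; apply: lerD.
    by rewrite -mulrA; apply: ler_pM.
  by rewrite mulrAC; apply: ler_pM.
- by apply: bounded_measurableD; exact: bounded_measurableM.
apply: filterS2 du dv => p Du Dv.
by have := is_derive_prod Du Dv; rewrite !move0.
Qed.

End TestFunctions.

(** * The regular set has full measure *)

Section RegularSet.
Context {R : realType}.
Variable al : R.
Local Notation mR := (measurableTypeR R).
Local Notation X3 := (mR * mR * mR)%type.
Implicit Types (p : X3) (N : set X3).

Let null_preimage_iter (f : X3 -> X3) N (k : nat) : measurable_fun setT f ->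
  (forall A : set X3, measurable A -> leb3 (f @^-1` A) = leb3 A) ->
  leb3.-negligible N -> leb3.-negligible (iter k f @^-1` N).
Proof.
move=> mf fP nN; elim: k => [//|k [A [mA A0 sA]]].
exists (f @^-1` A); split; last by move=> p /= Np; apply: sA; rewrite /= -iterSr.
  by rewrite -[X in measurable X]setTI; exact: mf.
by rewrite fP.
Qed.

(** The singular set is the union of two sets P_n in {0, pi} and of the preimage of
a third one under [step]; [step] and [unstep] preserve null sets. *)
Lemma ae_regular : {ae leb3, forall p, regular al (pt p)}.
Proof.
pose N := [set p : X3 | Sigma (coord al 1 p)] `|` [set p : X3 | Sigma (coord al 0 p)] `|`
  (step al @^-1` [set p : X3 | Sigma (coord al 0 p)]).
have nS n : leb3.-negligible [set p : X3 | Sigma (coord al n p)].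
  by apply/negligibleP; [exact: measurable_coord_Sigma | exact: leb3_coord_Sigma].
have nN : leb3.-negligible N.
  apply: negligibleU; first exact: negligibleU.
  apply: (@null_preimage_iter (step al) _ 1) => //; first exact: measurable_step.
  exact: leb3_preimage_step.
have SN p : singular al (pt p) -> N p.
  rewrite /singular /= -[yc (pt p)]/(trip (pt p)).1.2 -[zc (pt p)]/(trip (pt p)).2.
  rewrite -[xc (pt p)]/(trip (pt p)).1.1 ptK.
  by case=> [|[]] H; [left; left | left; right | right].
have iterT m p : iter m (T al) (pt p) = pt (iter (3 * m) (step al) p).
  elim: m => [|m IH]; first by rewrite muln0.
  rewrite iterS IH -[LHS]tripK T_step ptK mulnS.
  by rewrite -[(3 + 3 * m)%N]/(3 * m).+3.
have H1 m := null_preimage_iter (3 * m) (measurable_step al) (@leb3_preimage_step _ al) nN.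
have H2 m := null_preimage_iter (3 * m) (measurable_unstep al) (@leb3_preimage_unstep _ al) nN.
apply: negligibleS (negligibleU (negligible_bigcup H1) (negligible_bigcup H2)).
move=> p /= /contrapT [m _ [[s ss e]|e]]; last first.
  by left; exists m => //=; apply: SN; rewrite -iterT.
right; exists m => //=; apply: SN.
suff -> : iter (3 * m) (unstep al) p = trip s by rewrite tripK.
have -> : p = iter (3 * m) (step al) (trip s).
  by rewrite -[p]ptK -[RHS]ptK -iterT tripK e.
elim: (3 * m)%N => [//|k IH].
by rewrite iterSr /= stepK.
Qed.

End RegularSet.

(** * The limit field *)

Section LimitField.
Context {R : realType}.
Variables al b : R.
Local Notation pi := (@pi R).
Local Notation mR := (measurableTypeR R).
Local Notation X3 := (mR * mR * mR)%type.
Local Notation rV3 := 'rV[R]_3.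
Implicit Types (p : X3) (x : rV3).
Local Notation dir := (@dir R).

Hypothesis b16 : 16 <= b.
Hypothesis bE : al + 1 = b ^+ 2.

(** The ranks start at 2, the first one for which the x-component of the covector
cannot vanish. *)
Definition field (i n : nat) p : R :=
  match i with
  | 0 => curl al (dir 1) (dir 2) n.+2 p
  | 1 => curl al (dir 2) (dir 0) n.+2 p
  | _ => curl al (dir 0) (dir 1) n.+2 p
  end.

Definition limit_field (i : nat) p : R := limn (field i ^~ p).

Lemma field_cvg i p : field i ^~ p @ \oo --> limit_field i p.
Proof. by case: i => [|[|i]]; exact: (curl_cvg b16 bE). Qed.

Lemma field_bound i : exists K : R, forall n p, `|field i n p| <= K.
Proof. by case: i => [|[|i]]; exact: (curl_bound b16 bE). Qed.

Lemma bounded_measurable_field i n : bounded_measurable (field i n).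
Proof.
by case: i => [|[|i]]; apply: bounded_measurableB;
  exact: (bounded_measurable_dpot b16 bE).
Qed.

Lemma periodic3_field i n : periodic3 (field i n).
Proof.
by case: i => [|[|i]] p m1 m2 m3; congr (_ - _); exact: periodic3_dpot.
Qed.

Lemma measurable_limit_field i : measurable_fun setT (limit_field i : X3 -> mR).
Proof.
apply: (measurable_fun_cvg (h := fun n => field i n : X3 -> mR)).
  by move=> n; case: (bounded_measurable_field i n).
by move=> p _; exact: field_cvg.
Qed.

Lemma limit_field_bound i : exists K : R, forall p, `|limit_field i p| <= K.
Proof.
have [K hK] := field_bound i; exists K => p.
have c : (fun n => `|field i n p|) @ \oo --> `|limit_field i p|.
  by apply: cvg_norm; exact: field_cvg.
by apply: (cvgr_to_le c); apply: nearW => n; exact: hK.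
Qed.

Lemma periodic3_limit_field i : periodic3 (limit_field i).
Proof.
move=> p m1 m2 m3; rewrite /limit_field.
by congr (limn _); apply/funext => n; exact: periodic3_field.
Qed.

Lemma bounded_measurable_limit_field i : bounded_measurable (limit_field i).
Proof. by split; [exact: measurable_limit_field | exact: limit_field_bound]. Qed.

Lemma cell_Rintegral_field_cvg i (f : X3 -> mR) : bounded_measurable f ->
  (fun n => cell_Rintegral (fun p => field i n p * f p)) @ \oo -->
  cell_Rintegral (fun p => limit_field i p * f p).
Proof.
move=> [mf [C fC]]; have [K hK] := field_bound i.
apply: (@cell_Rintegral_cvg _ _ _ (K * C)).
- by move=> n; apply: measurable_funM => //; case: (bounded_measurable_field i n).
- by apply: measurable_funM => //; exact: measurable_limit_field.
- by move=> n p; rewrite normrM; apply: ler_pM.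
by apply: aeW => p; apply: cvgM; [exact: field_cvg | exact: cvg_cst].
Qed.

Let pot_slope i j n : slope_along (dir i) (pot al (dir j) n.+2)
  (dpot al (dir i) (dir j) n.+2).
Proof. by apply: slope_along_pot; exact: (bounded_measurable_dpot b16 bE). Qed.

Lemma mean_limit_field i : cell_Rintegral (limit_field i) = 0.
Proof.
have c := cell_Rintegral_field_cvg (i := i) (bounded_measurable_cst 1).
have e (u : X3 -> mR) : cell_Rintegral (fun p => u p * 1) = cell_Rintegral u.
  by congr cell_Rintegral; apply/funext => p; rewrite mulr1.
have z n : cell_Rintegral (fun p => field i n p * 1) = 0.
  rewrite e; case: i {c} => [|[|i]]; rewrite cell_RintegralB;
    try exact: (bounded_measurable_dpot b16 bE);
    by rewrite !(slope_mean0 (pot_slope _ _ _)) subrr.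
rewrite e (funext z) in c.
by rewrite -(cvg_lim (@Rhausdorff R) c) lim_cst.
Qed.

(** In the integral of curl A . grad f the six terms cancel in pairs by
[slope_swap]. *)
Lemma limit_field_div_free (f : X3 -> mR) (f' : nat -> X3 -> mR) :
  (forall i, (i < 3)%N -> slope_along (dir i) f (f' i)) ->
  cell_Rintegral (fun p => limit_field 0 p * f' 0%N p) +
  cell_Rintegral (fun p => limit_field 1 p * f' 1%N p) +
  cell_Rintegral (fun p => limit_field 2 p * f' 2%N p) = 0.
Proof.
move=> sf; have s0 := sf 0%N isT; have s1 := sf 1%N isT; have s2 := sf 2%N isT.
have b0 := slope_deriv_bounded s0; have b1 := slope_deriv_bounded s1.
have b2 := slope_deriv_bounded s2.
have c : (fun n => cell_Rintegral (fun p => field 0 n p * f' 0%N p) +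
    cell_Rintegral (fun p => field 1 n p * f' 1%N p) +
    cell_Rintegral (fun p => field 2 n p * f' 2%N p)) @ \oo -->
    cell_Rintegral (fun p => limit_field 0 p * f' 0%N p) +
    cell_Rintegral (fun p => limit_field 1 p * f' 1%N p) +
    cell_Rintegral (fun p => limit_field 2 p * f' 2%N p).
  by apply: cvgD; [apply: cvgD|]; exact: cell_Rintegral_field_cvg.
suff z n : cell_Rintegral (fun p => field 0 n p * f' 0%N p) +
    cell_Rintegral (fun p => field 1 n p * f' 1%N p) +
    cell_Rintegral (fun p => field 2 n p * f' 2%N p) = 0.
  by rewrite (funext z) in c; rewrite -(cvg_lim (@Rhausdorff R) c) lim_cst.
have bd i j := bounded_measurable_dpot b16 bE i j n.
have E i j (u : X3 -> mR) : bounded_measurable u ->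
    cell_Rintegral (fun p => curl al (dir i) (dir j) n.+2 p * u p) =
    cell_Rintegral (fun p => dpot al (dir i) (dir j) n.+2 p * u p) -
    cell_Rintegral (fun p => dpot al (dir j) (dir i) n.+2 p * u p).
  move=> bu; rewrite -cell_RintegralB; try exact: bounded_measurableM.
  by congr cell_Rintegral; apply/funext => p; rewrite -mulrBl.
rewrite /field !E //.
rewrite (slope_swap (pot_slope 1 2 n) (pot_slope 0 2 n) s1 s0).
rewrite (slope_swap (pot_slope 2 1 n) (pot_slope 0 1 n) s2 s0).
rewrite (slope_swap (pot_slope 2 0 n) (pot_slope 1 0 n) s2 s1).
move: (cell_Rintegral _) (cell_Rintegral _) (cell_Rintegral _) => c0 c1 c2; ring.
Qed.

(** The second component of curl A is d_z A_x - d_x A_z.  Against f = h(z), whose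
gradient is (0, 0, s), its integral is that of - A_x s = - psi_n, because the
x-component of the normalised covector is 1 and s^2 = 1. *)
Lemma limit_field_neq0 : ~ {ae leb3, forall p, limit_field 1 p = 0}.
Proof.
move=> z.
pose f p : mR := h (coord al 0 p).
have sf d : slope_along d f (fun p => sgn al p 0 * d.2).
  have [L hL] := coord_lipschitz al d 0.
  split.
  - split; first exact: measurableT_comp (@measurable_h R) (measurable_coord al 0).
    by exists pi => p; rewrite ger0_norm ?h_ge0 // h_le_pi.
  - exact: (periodic3_coord al 0 (@hD R)).
  - exists L => p t; exact: le_trans (h_lipschitz _ _) (hL p t).
  - split; first by apply: measurable_funM => //; exact: measurable_sgn.
    by exists `|d.2| => p; rewrite normrM normr_sgn mul1r.
  apply: filterS (ae_coord al) => p nS.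
  have D := coord_is_derive d (fun j (_ : (j < 0)%N) => nS j).
  exact: (is_derive_comp_coord (h_is_derive (nS 0%N)) D).
have bf : bounded_measurable f := slope_bounded (sf (dir 0)).
have c := cell_Rintegral_field_cvg (i := 1) bf.
have lim0 : cell_Rintegral (fun p => limit_field 1 p * f p) = 0.
  have bl := bounded_measurableM (bounded_measurable_limit_field 1) bf.
  have : (fun n : nat => cell_Rintegral (fun=> 0 : R)) @ \oo -->
      cell_Rintegral (fun p => limit_field 1 p * f p).
    apply: (@cell_Rintegral_cvg _ (fun _ _ => 0) _ 0) => //.
    - by case: bl.
    - by move=> n p; rewrite normr0.
    by apply: filterS z => p ->; rewrite mul0r; exact: cvg_cst.
  by move=> /(cvg_lim (@Rhausdorff R)) <-; rewrite lim_cst // cell_Rintegral_cst mul0r.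
rewrite lim0 in c.
have E n : cell_Rintegral (fun p => field 1 n p * f p) = - cell_Rintegral (psi al n.+2).
  have m1 := slope_alongM (pot_slope 2 0 n) (sf (dir 2)).
  have m2 := slope_alongM (pot_slope 0 2 n) (sf (dir 0)).
  have b1 := slope_deriv_bounded m1; have b2 := slope_deriv_bounded m2.
  have bp := bounded_measurable_psi al n.+2.
  transitivity (cell_Rintegral (fun p =>
      (dpot al (dir 2) (dir 0) n.+2 p * f p
         + pot al (dir 0) n.+2 p * (sgn al p 0 * (dir 2).2))
      - (dpot al (dir 0) (dir 2) n.+2 p * f p
         + pot al (dir 2) n.+2 p * (sgn al p 0 * (dir 0).2))
      - psi al n.+2 p)).
    congr cell_Rintegral; apply/funext => p.
    have -> : psi al n.+2 p = pot al (dir 0) n.+2 p * sgn al p 0.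
      rewrite /pot (slope_dir0 b16 bE) mulr1 mulrAC.
      by rewrite (slope_sign_sq (coord al 0 p)) mul1r.
    rewrite /field /curl -[(dir 2).2]/(1 : R) -[(dir 0).2]/(0 : R).
    move: (pot _ _ _ _) (pot _ _ _ _) (dpot _ _ _ _ _) (dpot _ _ _ _ _)
      (f p) (sgn _ _ _) => a0 a2 d0 d2 u s.
    ring.
  rewrite cell_RintegralB //; last exact: bounded_measurableB.
  by rewrite cell_RintegralB // (slope_mean0 m1) (slope_mean0 m2) subrr sub0r.
have p2 : 2 <= pi := pi_ge2 R.
have k0 : 0 < (2 * pi) ^+ 3 - (2 * pi) ^+ 2 :> R.
  rewrite (_ : _ - _ = (2 * pi - 1) * (2 * pi) ^+ 2); last by ring.
  by apply: mulr_gt0; [lra | apply: exprn_gt0; lra].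
suff : 0 <= - ((2 * pi) ^+ 3 - (2 * pi) ^+ 2) :> R by lra.
apply: (cvgr_to_le c); apply: nearW => n; rewrite E lerN2.
apply: le_trans (cell_Rintegral_psi al n.+2); rewrite lerD2l lerN2.
rewrite -[leRHS]mulr1 ler_wpM2l ?exprn_ge0 //; lra.
Qed.

End LimitField.

Section Membership.
Context {R : realType}.
Variables al b : R.
Local Notation rV3 := 'rV[R]_3.
Implicit Types (x : rV3).
Hypothesis b16 : 16 <= b.
Hypothesis bE : al + 1 = b ^+ 2.
Variables (Lu Ls kappa : R) (Eu Es : rV3 -> {vspace rV3}).
Hypothesis H : hyperbolic_splitting al Lu Ls kappa Eu Es.

Definition field_vec x : rV3 :=
  vec3 (limit_field al 0 (trip x)) (limit_field al 1 (trip x))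
    (limit_field al 2 (trip x)).

(** Let w be the vector of E^u with the same y- and z-component as the field.  Both
w and the field are annihilated by the limit covector, the field because
B_n is orthogonal to eta_n for every n; as the x-component of that covector is
1, their x-components agree too. *)
Lemma field_vec_in_Eu x : regular al x -> field_vec x \in Eu x.
Proof.
move=> rx; set p := trip x.
have [w wE [w1 w2]] := Eu_graph b16 bE H (limit_field al 1 p) (limit_field al 2 p) rx.
suff w0 : xc w = limit_field al 0 p.
  by rewrite /field_vec -/p -w0 -w1 -w2 -[vec3 _ _ _]/(pt (trip w)) tripK.
pose k n := (3 * n)%N.
have kk : k @ \oo --> \oo.
  apply/cvgnyPge => N; near=> n; apply: (@leq_trans n); last by rewrite leq_pmull.
  by near: n; exact: nbhs_infty_ge.
have cf i : (fun n => field al i (k n) p) @ \oo --> limit_field al i p.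
  exact: cvg_comp kk (@field_cvg _ al b b16 bE i p).
pose s1 n := slope al (sgn al p) (dir 1) (k n).+2.
pose s2 n := slope al (sgn al p) (dir 2) (k n).+2.
have [C1 h1] := slope_bound b16 bE 1; have [C2 h2] := slope_bound b16 bE 2.
have cw := Eu_slope b16 bE H rx wE.
have z (u v : nat -> R) (C : R) : u @ \oo --> (0 : R) -> (forall n, `|v n| <= C) ->
    (fun n => u n * v n) @ \oo --> (0 : R).
  move=> u0 vC; apply/norm_cvg0P.
  have u1 : (fun n => `|u n| * C) @ \oo --> (0 : R).
    by rewrite -(mul0r C); apply: cvgMl; rewrite -(normr0 R); exact: cvg_norm.
  apply: (squeeze_cvgr _ (cvg_cst 0) u1); apply: nearW => n.
  by rewrite normr_ge0 /= normrM ler_wpM2l.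
have d i c : c = limit_field al i p -> (fun n => c - field al i (k n) p) @ \oo --> (0 : R).
  by move=> ->; rewrite -(subrr (limit_field al i p)); apply: cvgB => //; exact: cvg_cst.
have z1 := z _ s1 C1 (d 1%N _ w1) (fun n => h1 (k n) p).
have z2 := z _ s2 C2 (d 2%N _ w2) (fun n => h2 (k n) p).
have cc := cvgB (cvgB cw z1) z2.
have e n : xc w - field al 0 (k n) p =
  (xc w + yc w * s1 n + zc w * s2 n) - (yc w - field al 1 (k n) p) * s1 n
  - (zc w - field al 2 (k n) p) * s2 n.
  rewrite /field /curl /dpot -/(s1 n) -/(s2 n) (slope_dir0 b16 bE).
  move: (s1 n) (s2 n) => c1 c2; ring.
have c0 : (fun n => xc w - field al 0 (k n) p) @ \oo --> (0 : R).
  rewrite (funext e) -[X in _ --> X]subr0 -{1}[X in _ --> X - _]subr0.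
  by apply: cvgB => //; exact: cvgB.
have c1 : (fun n => xc w - field al 0 (k n) p) @ \oo --> xc w - limit_field al 0 p.
  by apply: cvgB => //; exact: cvg_cst.
apply/eqP; rewrite -subr_eq0 -(cvg_lim (@Rhausdorff R) c1).
by rewrite (cvg_lim (@Rhausdorff R) c0).
Unshelve. all: by end_near. Qed.

Let field_vec_entry p (i : 'I_3) : field_vec (pt p) 0 i = limit_field al i p.
Proof. by rewrite /field_vec ptK; exact: (vec3_entry (limit_field al ^~ p)). Qed.

Lemma field_vec_periodic : Defs.periodic field_vec.
Proof.
move=> x k _; rewrite /field_vec; pose q := trip x.
have -> : trip (x + \row_i ((k i)%:~R * (2 * pi))) =
    (q.1.1 + (k 0)%:~R * (2 * pi), q.1.2 + (k 1)%:~R * (2 * pi),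
     q.2 + (k 2)%:~R * (2 * pi)).
  by rewrite /trip /xc /yc /zc !mxE.
by rewrite !periodic3_limit_field.
Qed.

Lemma field_vec_Linfty : Linfty_field field_vec.
Proof.
split; first exact: field_vec_periodic.
move=> i; rewrite (_ : (fun p => _) = limit_field al i); last first.
  by apply/funext => p; rewrite field_vec_entry.
split; first exact: (measurable_limit_field b16 bE).
have [K hK] := limit_field_bound b16 bE i.
rewrite /finite_norm unlock; case: ifP => _; last exact: ltry.
apply: (@le_lt_trans _ _ K%:E); last exact: ltry.
by apply/ess_supP; apply: aeW => p; rewrite /= lee_fin.
Qed.

Lemma field_vec_mean_free : mean_free field_vec.
Proof.
move=> i; under eq_integral do rewrite field_vec_entry.
by rewrite (cell_RintegralE (bounded_measurable_limit_field b16 bE i)) (mean_limit_field b16 bE).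
Qed.

Lemma field_vec_div_free : div_free field_vec.
Proof.
move=> phi pphi sphi.
pose f' (i : nat) p := partial (inord i) phi (pt p).
have sf i : (i < 3)%N -> slope_along (dir i) (fun p => phi (pt p)) (f' i).
  move=> i3; have := slope_along_test (inord i) pphi sphi.
  by rewrite inordK.
have bf i (i3 : (i < 3)%N) := bounded_measurableM
  (bounded_measurable_limit_field b16 bE i) (slope_deriv_bounded (sf i i3)).
rewrite (_ : integral _ _ _ = (cell_Rintegral (fun p => limit_field al 0 p * f' 0%N p
    + limit_field al 1 p * f' 1%N p + limit_field al 2 p * f' 2%N p))%:E).
  rewrite !cell_RintegralD ?(limit_field_div_free b16 bE sf) //.
  - exact: (bf 0%N).
  - exact: (bf 1%N).
  - by apply: bounded_measurableD; [exact: (bf 0%N) | exact: (bf 1%N)].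
  - exact: (bf 2%N).
rewrite -cell_RintegralE; last first.
  apply: bounded_measurableD; [apply: bounded_measurableD|].
  - exact: (bf 0%N).
  - exact: (bf 1%N).
  - exact: (bf 2%N).
apply: eq_integral => p _; congr (_%:E).
by rewrite sum3 !field_vec_entry !inordK.
Qed.

Lemma field_vec_neq0 : ~ (\forall p \ae leb3, field_vec (pt p) = 0).
Proof.
move=> z; apply: (limit_field_neq0 b16 bE); apply: filterS z => p e.
by have := field_vec_entry p 1; rewrite e mxE.
Qed.

End Membership.

Theorem proposition5p1 (R : realType) :
  exists alpha0 : R, 0 < alpha0 /\
  forall alpha : R, alpha0 <= alpha ->
  forall (Lu Ls kappa : R) (Eu Es : 'rV[R]_3 -> {vspace 'rV[R]_3}),
  hyperbolic_splitting alpha Lu Ls kappa Eu Es ->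
  exists B0 : 'rV[R]_3 -> 'rV[R]_3,
    [/\ Linfty_field B0,
        ~ (\forall p \ae leb3, B0 (pt p) = 0),
        mean_free B0,
        div_free B0 &
        \forall p \ae leb3, B0 (pt p) \in Eu (pt p)].
Proof.
exists 255; split; first by lra.
move=> al al0 Lu Ls kappa Eu Es H.
pose b := Num.sqrt (al + 1).
have bE : al + 1 = b ^+ 2 by rewrite sqr_sqrtr //; lra.
have b16 : 16 <= b.
  have b0 : 0 <= b by exact: sqrtr_ge0.
  rewrite leNgt; apply/negP => b16.
  have : 0 < (16 - b) * (16 + b) by apply: mulr_gt0; lra.
  by move: bE; rewrite expr2; lra.
exists (field_vec al); split.
- exact: (field_vec_Linfty b16 bE).
- exact: (field_vec_neq0 b16 bE).
- exact: (field_vec_mean_free b16 bE).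
- exact: (field_vec_div_free b16 bE).
- by apply: filterS (ae_regular al) => p rp; exact: (field_vec_in_Eu b16 bE H rp).
Qed.
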